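(* Assume (A1) $X$ is $C^\infty$; (A2) $\sigma_{\min}\big[\int_{\mathcal{R}}\frac{\rho}{\Delta t^2}\frac{\partial X}{\partial\theta}(x,\theta_-)^T\frac{\partial X}{\partial\theta}(x,\theta_-)\,dx\big]\ge\sigma_X>0$; (A3) for every $x\in\mathcal{C}$, $\partial^3 v_x/\partial\theta^3$ exists and is continuous. Then there exist $r>0$ and $\alpha_1>0$ such that for every $\alpha\in(0,\alpha_1]$ and every feasible $w$, the negative gradient flow $\dot\theta(t)=-\nabla_\theta V_\alpha(\theta(t),w)$ with $\theta(0)=\theta_-$, where $V_\alpha(\theta,w)=\|G_\alpha(\theta,w)\|^2$, converges to a solution $\theta$ of $G_\alpha(\theta,w)=0$, and this solution lies in the ball $\mathcal{B}(\theta_-,r)$.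
   Context: A configuration is $\theta\in\mathbb{R}^n$; the robot occupies a region $\mathcal{R}\subset\mathbb{R}^3$ with density $\rho>0$; $X(x,\theta)\in\mathbb{R}^3$ is forward kinematics; $\mathcal{C}\subset\mathcal{R}$ is a finite set of contact points; for each $x\in\mathcal{C}$, $v_x:\mathbb{R}^n\to\mathbb{R}^{3\times V_x}$ is a matrix-valued function and $w_x\in\mathbb{R}^{V_x}$; $w$ is the concatenation of the $w_x$, feasible if $w_x\ge0$ and $\mathbf{1}^Tw_x\le1$ for every $x$. Fixed data: $\Delta t>0$, $\theta_-,\theta_{--},\tau\in\mathbb{R}^n$, $\alpha\in(0,1]$. $A(\theta)=\int_{\mathcal{R}}\frac{\rho}{\Delta t^2}\frac{\partial X}{\partial\theta}(x,\theta)^T(X(x,\theta)-X(x,\theta_-))dx$, $B(\theta,w)=\int_{\mathcal{R}}\frac{\rho}{\Delta t^2}\frac{\partial X}{\partial\theta}(x,\theta)^T(X(x,\theta_{--})-X(x,\theta_-))dx-\sum_{x\in\mathcal{C}}\frac{\partial X}{\partial\theta}(x,\theta)^Tv_x(\theta)w_x-\tau$, and $G_\alpha(\theta,w)=\frac1\alpha A(\theta)+B(\theta,w)$. $\mathcal{B}(\theta_-,r)$ is the closed Euclidean ball of radius $r$ around $\theta_-$. *)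

(* Defs.v *)
From HB Require Import structures.
From mathcomp Require Import all_boot all_order all_algebra.
From mathcomp Require Import all_classical all_reals all_analysis.
Set Implicit Arguments. Unset Strict Implicit. Unset Printing Implicit Defensive.
Import Order.TTheory GRing.Theory Num.Theory.
Import numFieldNormedType.Exports.
Local Open Scope classical_set_scope.
Local Open Scope ring_scope.

Section Robot.
Variable R : realType.

Definition leb3 :=
  ((@lebesgue_measure R \x @lebesgue_measure R) \x @lebesgue_measure R)%E.

Definition tr3 (p : (R * R) * R) : 'rV[R]_3 :=
  \row_(i < 3) [:: p.1.1; p.1.2; p.2]`_i.

Definition rint3 (D : set 'rV[R]_3) (f : 'rV[R]_3 -> R) : R :=
  Rintegral leb3 (tr3 @^-1` D) (f \o tr3).

Fixpoint Ck (V W : normedModType R) (k : nat) (f : V -> W) : Prop :=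
  match k with
  | 0 => continuous f
  | k'.+1 => [/\ continuous f, (forall p u, derivable f p u) &
                 forall u, Ck k' (fun p => 'D_u f p)]
  end.

Definition smooth (V W : normedModType R) (f : V -> W) : Prop :=
  forall k, Ck k f.

Variable n : nat.

Definition ev (j : 'I_n) : 'rV[R]_n := delta_mx 0 j.

Definition jac (X : 'rV[R]_3 -> 'rV[R]_n -> 'rV[R]_3) (x : 'rV[R]_3)
  (th : 'rV[R]_n) : 'M[R]_(3, n) :=
  \matrix_(k < 3, j < n) ('D_(ev j) (X x) th) 0 k.

Definition grad (f : 'rV[R]_n -> R) (th : 'rV[R]_n) : 'rV[R]_n :=
  \row_(j < n) 'D_(ev j) f th.

Definition sqnorm (u : 'rV[R]_n) : R := \sum_(j < n) u 0 j ^+ 2.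

Variables (rho dt : R) (region : set 'rV[R]_3)
  (X : 'rV[R]_3 -> 'rV[R]_n -> 'rV[R]_3) (thm thmm tau : 'rV[R]_n)
  (m : nat) (c : 'I_m -> 'rV[R]_3) (Vd : 'I_m -> nat)
  (v : forall i : 'I_m, 'rV[R]_n -> 'M[R]_(3, Vd i)).

Definition Aop (th : 'rV[R]_n) : 'rV[R]_n :=
  \row_(j < n) rint3 region (fun x =>
     rho / dt ^+ 2 * (((X x th - X x thm) *m jac X x th) 0 j)).

Definition Bop (th : 'rV[R]_n) (w : forall i : 'I_m, 'cV[R]_(Vd i))
  : 'rV[R]_n :=
  \row_(j < n) rint3 region (fun x =>
     rho / dt ^+ 2 * (((X x thmm - X x thm) *m jac X x th) 0 j))
  - \sum_(i < m) ((v i th *m w i)^T *m jac X (c i) th)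
  - tau.

Definition Gop (al : R) (th : 'rV[R]_n) (w : forall i : 'I_m, 'cV[R]_(Vd i))
  : 'rV[R]_n := al^-1 *: Aop th + Bop th w.

Definition Vop (al : R) (th : 'rV[R]_n) (w : forall i : 'I_m, 'cV[R]_(Vd i))
  : R := sqnorm (Gop al th w).

Definition Mmat : 'M[R]_n :=
  \matrix_(i < n, j < n) rint3 region (fun x =>
     rho / dt ^+ 2 * (((jac X x thm)^T *m jac X x thm) i j)).

Definition sigma_min_ge (M : 'M[R]_n) (s : R) : Prop :=
  forall a : R, eigenvalue (M^T *m M) a -> s <= Num.sqrt a.

Definition feasible (w : forall i : 'I_m, 'cV[R]_(Vd i)) : Prop :=
  forall i, (forall k, 0 <= w i k 0) /\ \sum_(k < Vd i) w i k 0 <= 1.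

Definition grad_flow (f : 'rV[R]_n -> R) (th0 : 'rV[R]_n)
  (th : R -> 'rV[R]_n) : Prop :=
  th 0 = th0 /\ forall t : R, 0 <= t -> is_derive t 1 th (- grad f (th t)).

End Robot.

(* Main.v *)
Require Import Defs.
From HB Require Import structures.
From mathcomp Require Import all_boot all_order all_algebra.
From mathcomp Require Import all_classical all_reals all_analysis.
From mathcomp Require Import ring lra.
Import Order.TTheory GRing.Theory Num.Theory.
Import numFieldNormedType.Exports.
Local Open Scope classical_set_scope.
Local Open Scope ring_scope.
Set Implicit Arguments.
Unset Strict Implicit.
Unset Printing Implicit Defensive.

(** Write [alpha * G_alpha = A + alpha * B]. Since [A(theta_-) = 0] and [DA(theta_-)] is the matrix
    of (A2), the Jacobian of [alpha * G_alpha] stays uniformly invertible on a ball around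
    [theta_-] when [alpha] is small, uniformly in the feasible [w]; hence the Lojasiewicz
    inequality [4 mu^2 V <= |grad V|^2] holds there with [mu] of order [1 / alpha], while
    [V(theta_-)] does not depend on [alpha]. Such an inequality bounds the length of the gradient
    flow by [sqrt V(theta_-) / mu = O(alpha)], so the flow cannot leave the ball and converges to a
    zero of [V]. Existence of the flow is Picard iteration for the field clamped to a cube. *)

(** On row vectors [|x|] is the sup norm, so the sets [|x - z| <= r] are cubes, while [V] and the
    final ball are Euclidean; the factors [n.+1] pay for the passage between the two, the successor
    keeping constants nonzero when [n = 0]. [Ck] speaks of directional derivatives only, so the mean
    value and chain rules are derived along the coordinate axes. Uniformity in [w] comes from
    linearity: [w] enters [G] through finitely many coefficients, which feasibility places in
    [[0, 1]]. *)

(** * Closure properties of the class [Ck] *)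

Section CkCalculus.
Variables (R : realType) (V : normedModType R).
Implicit Types (f g : V -> R) (k : nat).

Lemma CkW (W : normedModType R) k (f : V -> W) : Ck k.+1 f -> Ck k f.
Proof.
elim: k f => [|k IH] f; first by case.
by case=> cf df Df; split => // u; apply: IH; exact: Df.
Qed.

Lemma Ck_le (W : normedModType R) k l (f : V -> W) : (l <= k)%N -> Ck k f -> Ck l f.
Proof.
elim: k => [|k IH]; first by rewrite leqn0 => /eqP ->.
by rewrite leq_eqVlt => /predU1P[->//|lk] /CkW; exact: IH.
Qed.

Lemma Ck_continuous (W : normedModType R) k (f : V -> W) : Ck k f -> continuous f.
Proof. by case: k => [|k] //; case. Qed.

Lemma Ck_cst (W : normedModType R) k (a : W) : Ck k (fun _ : V => a).
Proof.
elim: k a => [|k IH] a; first by move=> x; exact: cvg_cst.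
split; first by move=> x; exact: cvg_cst.
  by move=> p u; exact: derivable_cst.
move=> u; have -> : (fun p => 'D_u (fun _ : V => a) p) = (fun=> 0 : W).
  by apply/funext => p; exact: derive_cst.
exact: IH.
Qed.

Lemma CkD k f g : Ck k f -> Ck k g -> Ck k (fun x => f x + g x).
Proof.
elim: k f g => [|k IH] f g; first by move=> cf cg x; apply: cvgD; [exact: cf|exact: cg].
case=> cf df Df [cg dg Dg]; split.
- by move=> x; apply: cvgD; [exact: cf|exact: cg].
- by move=> p u; apply: (@derivableD _ _ _ f g).
- move=> u; rewrite (_ : (fun p => _) = fun p => 'D_u f p + 'D_u g p).
    by apply: IH; [exact: Df|exact: Dg].
  by apply/funext => p; rewrite (@deriveD _ _ _ f g).
Qed.

Lemma CkM k f g : Ck k f -> Ck k g -> Ck k (fun x => f x * g x).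
Proof.
elim: k f g => [|k IH] f g; first by move=> cf cg x; apply: cvgM; [exact: cf|exact: cg].
move=> Cf Cg; have [Cf' Cg'] := (CkW Cf, CkW Cg).
case: Cf Cg => cf df Df [cg dg Dg]; split.
- by move=> x; apply: cvgM; [exact: cf|exact: cg].
- by move=> p u; apply: (@derivableM _ _ f g).
- move=> u; rewrite (_ : (fun p => _) = fun p => f p * 'D_u g p + g p * 'D_u f p).
    by apply: CkD; apply: IH => //; [exact: Dg|exact: Df].
  by apply/funext => p; rewrite (@deriveM _ _ f g).
Qed.

Lemma CkN k f : Ck k f -> Ck k (fun x => - f x).
Proof.
move=> Cf; rewrite (_ : (fun x => _) = (fun x => -1 * f x)).
  by apply: CkM => //; exact: Ck_cst.
by apply/funext => x; rewrite mulN1r.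
Qed.

Lemma CkB k f g : Ck k f -> Ck k g -> Ck k (fun x => f x - g x).
Proof. by move=> Cf Cg; apply: (CkD Cf); exact: CkN. Qed.

Lemma Ck_sum (I : Type) (s : seq I) (P : pred I) k (f : I -> V -> R) :
  (forall i, Ck k (f i)) -> Ck k (fun x => \sum_(i <- s | P i) f i x).
Proof.
move=> Cf; elim: s => [|i s IH].
  have -> : (fun x => \sum_(i <- [::] | P i) f i x) = (fun=> 0).
    by apply/funext => x; rewrite big_nil.
  exact: Ck_cst.
have -> : (fun x => \sum_(i <- i :: s | P i) f i x) =
    (fun x => (if P i then f i x else 0) + \sum_(i <- s | P i) f i x).
  by apply/funext => x; rewrite big_cons; case: ifP => //; rewrite add0r.
by apply: CkD => //; case: (P i) => //; exact: Ck_cst.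
Qed.

Lemma Ck_mxcoord m n k (f : V -> 'M[R]_(m, n)) i j : Ck k f -> Ck k (fun x => f x i j).
Proof.
have C0 (g : V -> 'M[R]_(m, n)) : continuous g -> continuous (fun x => g x i j).
  by move=> cg x; apply: (@continuous_comp _ _ _ g (fun M : 'M[R]_(m, n) => M i j)); [exact: cg|exact: coord_continuous].
elim: k f => [|k IH] f; first exact: C0.
case=> cf df Df; split; first exact: C0.
  by move=> p u; move: (df p u) => /derivable_mxP.
move=> u; have -> : (fun p => 'D_u (fun x => f x i j) p) = (fun p => ('D_u f p) i j).
  by apply/funext => p; rewrite derive_mx// mxE.
exact/IH/Df.
Qed.

End CkCalculus.

(** * Precomposition with affine maps *)

Section CkAffine.
Variables (R : realType) (U V : normedModType R).
Variables (L L' : U -> V).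
Hypothesis affineL : forall h p u, L (h *: u + p) = h *: L' u + L p.

(** [L'] is the linear part of [L]. The difference quotient of [f \o L] at [p] along [u] is
    literally that of [f] at [L p] along [L' u]; typical cases are maps such as [row_mx x], which
    freeze part of the variable. *)
Lemma derivable_affine (W : normedModType R) (f : V -> W) p u :
  derivable f (L p) (L' u) -> derivable (f \o L) p u.
Proof.
by rewrite /derivable (_ : (fun h => _) =
  (fun h : R => h^-1 *: ((f \o L) (h *: u + p) - (f \o L) p)))//; apply/funext => h /=; rewrite affineL.
Qed.

Lemma derive_affine (W : normedModType R) (f : V -> W) p u :
  'D_u (f \o L) p = 'D_(L' u) f (L p).
Proof.
by rewrite /derive (_ : (fun h => _) =
  (fun h : R => h^-1 *: (f (h *: L' u + L p) - f (L p))))//; apply/funext => h /=; rewrite affineL.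
Qed.

Lemma Ck_affine (W : normedModType R) k (f : V -> W) :
  continuous L -> Ck k f -> Ck k (f \o L).
Proof.
move=> cL; have C0 (g : V -> W) : continuous g -> continuous (g \o L).
  by move=> cg x; apply: continuous_comp; [exact: cL|exact: cg].
elim: k f => [|k IH] f; first exact: C0.
case=> cf df Df; split; first exact: C0.
  by move=> p u; exact/derivable_affine/df.
move=> u; rewrite (_ : (fun p => _) = (fun p => 'D_(L' u) f p) \o L); first exact/IH/Df.
by apply/funext => p; rewrite derive_affine.
Qed.

End CkAffine.

(** * Mean value theorems and the chain rule from directional derivatives *)

Section C1Calculus.
Variable R : realType.

Lemma cvg_fsum (T I : Type) (F : set_system T) (FF : Filter F) (s : seq I)
  (f : I -> T -> R) (l : I -> R) :
  (forall i, f i x @[x --> F] --> l i) ->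
  \sum_(i <- s) f i x @[x --> F] --> \sum_(i <- s) l i.
Proof.
move=> fl; elim: s => [|i s IH].
  rewrite big_nil; under eq_fun do rewrite big_nil.
  exact: cvg_cst.
rewrite big_cons; under eq_fun do rewrite big_cons.
by apply: cvgD.
Qed.

Lemma is_derive_cvg (V W : normedModType R) (f : V -> W) (x u : V) (l : W) :
  (h^-1 *: (f (h *: u + x) - f x)) @[h --> (0 : R)^'] --> l -> is_derive x u f l.
Proof.
move=> fl; split; first by apply/cvg_ex; exists l.
exact/cvg_lim.
Qed.

Lemma cvg_is_derive (V W : normedModType R) (f : V -> W) (x u : V) (l : W) :
  is_derive x u f l -> (h^-1 *: (f (h *: u + x) - f x)) @[h --> (0 : R)^'] --> l.
Proof. by case=> df <-; exact: df. Qed.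

Lemma is_derive_continuous (W : normedModType R) (f : R -> W) (x : R) (l : W) :
  is_derive x 1 f l -> {for x, continuous f}.
Proof. by case=> /derivable1_diffP /differentiable_continuous. Qed.

Lemma normr_continuous (V : normedModType R) (f : V -> R) :
  continuous f -> continuous (fun x => `|f x|).
Proof. by move=> cf x; apply: cvg_norm; exact: cf. Qed.

Lemma dist_continuous (V : normedModType R) (p : V) : continuous (fun x => `|x - p|).
Proof. by move=> x; apply: cvg_norm; apply: cvgB; [exact: cvg_id|exact: cvg_cst]. Qed.

Lemma is_derive_mxcoord (V : normedModType R) m n (f : V -> 'M[R]_(m, n)) (x u : V)
  (l : 'M[R]_(m, n)) i j :
  is_derive x u f l -> is_derive x u (fun y => f y i j) (l i j).
Proof.
case=> df <-; split; first by move: df => /derivable_mxP.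
by rewrite derive_mx// mxE.
Qed.

Lemma is_derive_row (V : normedModType R) n (f : V -> 'rV[R]_n) (x u : V) (l : 'rV[R]_n) :
  (forall j, is_derive x u (fun y => f y 0 j) (l 0 j)) -> is_derive x u f l.
Proof.
move=> H; have df : derivable f x u.
  by apply/derivable_mxP => i j; rewrite ord1; have [] := H j.
split => //; rewrite derive_mx//; apply/rowP => j; rewrite mxE.
by have [_ ->] := H j.
Qed.

Section Vec.
Variable n : nat.
Implicit Types (p q u x y z : 'rV[R]_n) (f : 'rV[R]_n -> R).

Lemma coord_le_norm u j : `|u 0 j| <= `|u|.
Proof.
rewrite [leRHS]/Num.Def.normr /= mx_normrE.
by apply/bigmax_geP; right; exists (0, j).
Qed.

Lemma norm_rV_le u (e : R) : 0 <= e -> (forall j, `|u 0 j| <= e) -> `|u| <= e.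
Proof.
move=> e0 ue; rewrite [leLHS]/Num.Def.normr /= mx_normrE.
by apply: bigmax_le => // -[i j] _ /=; rewrite ord1.
Qed.

Lemma is_derive_line f p u s : derivable f (s *: u + p) u ->
  is_derive s (1 : R) (fun s => f (s *: u + p)) ('D_u f (s *: u + p)).
Proof.
have aff h (s' w : R) : (h *: w + s') *: u + p = h *: (w *: u) + (s' *: u + p).
  by rewrite scalerDl scalerA addrA.
move=> df; split.
  by apply: (derivable_affine aff); rewrite scale1r.
by have := derive_affine aff f s 1; rewrite scale1r.
Qed.

(** The left side is the derivative along [a] of the one-variable function [s |-> f (s *: u + p)];
    on the line, derivability is differentiability, and the differential is linear. *)
Lemma deriveZ_dir f p u (a : R) : derivable f p u ->
  'D_(a *: u) f p = a * 'D_u f p.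
Proof.
have aff h (s' w : R) : (h *: w + s') *: u + p = h *: (w *: u) + (s' *: u + p).
  by rewrite scalerDl scalerA addrA.
move=> df; have := derive_affine aff f 0 a; rewrite scale0r add0r => <-.
have := @is_derive_line f p u 0; rewrite scale0r add0r => /(_ df) [dg Dg].
rewrite deriveE; last exact/derivable1_diffP.
by rewrite -{1}[a]mulr1 -[a * 1]/(a *: 1) linearZ /= -deriveE ?Dg//; exact/derivable1_diffP.
Qed.

Lemma MVT_dir f p u : (forall x, derivable f x u) ->
  exists2 c : R, 0 <= c <= 1 & f (u + p) - f p = 'D_u f (c *: u + p).
Proof.
move=> df.
have dl s : is_derive s (1 : R) (fun s => f (s *: u + p)) ('D_u f (s *: u + p)).
  exact: is_derive_line.
have [c] := @MVT_segment R (fun s => f (s *: u + p)) (fun s => 'D_u f (s *: u + p)) 0 1 ler01 (fun s _ => dl s) (continuous_subspaceT (fun s => is_derive_continuous (dl s))).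
rewrite in_itv /= => c01; rewrite scale1r scale0r add0r subr0 mulr1 => ->.
by exists c.
Qed.

(** Directional derivatives need not be linear in the direction, so the increment is telescoped
    along an axis-parallel path: [q k] has its first [k] coordinates already moved, and each leg is
    a one-dimensional mean value theorem. The points [xi j] may leave the segment but stay in the
    box with corners [p] and [u + p]. *)
Lemma MVT_coords f p u : (forall x w, derivable f x w) ->
  exists2 xi : 'I_n -> 'rV[R]_n,
    forall j i, exists2 s : R, 0 <= s <= 1 & xi j 0 i = p 0 i + s * u 0 i &
    f (u + p) - f p = \sum_(j < n) u 0 j * 'D_(ev R j) f (xi j).
Proof.
move=> df.
pose q (k : nat) : 'rV[R]_n := p + \row_(j < n) (if (j < k)%N then u 0 j else 0).
have qS (j : 'I_n) : q j.+1 = u 0 j *: ev R j + q j.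
  apply/rowP => i; rewrite !mxE ltnS leq_eqVlt eqxx /=.
  rewrite [in RHS]addrCA; congr (_ + _).
  rewrite -(val_eqE i j) /=.
  by case: eqVneq => [/val_inj ->|_] /=; rewrite ?ltnn ?mulr1 ?mulr0 ?addr0 ?add0r.
have step (j : 'I_n) : exists x : 'rV[R]_n,
   (forall i, exists2 s : R, 0 <= s <= 1 & x 0 i = p 0 i + s * u 0 i) /\
   f (q j.+1) - f (q j) = u 0 j * 'D_(ev R j) f x.
  rewrite qS; have [c c01 ->] := @MVT_dir f (q j) (u 0 j *: ev R j) (fun x => df x _).
  exists (c *: (u 0 j *: ev R j) + q j); split; last by rewrite deriveZ_dir.
  move=> i; rewrite !mxE eqxx /=; have [ij|ij] := eqVneq j i.
    by exists c => //; rewrite ij ltnn addr0 /= mulr1 addrC.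
  rewrite /= !mulr0 add0r; case: ifP => _.
    by exists 1; rewrite ?lexx ?ler01// mul1r.
  by exists 0; rewrite ?lexx ?ler01// mul0r.
have [xi xiP] := choice step.
exists xi; first by move=> j; exact: (xiP j).1.
have -> : u + p = q n.
  by rewrite addrC; congr (_ + _); apply/rowP => i; rewrite mxE ltn_ord.
have -> : p = q 0%N.
  by apply/rowP => i; rewrite !mxE /= addr0.
rewrite -(telescope_sumr (fun k => f (q k)) (leq0n n)) big_mkord.
by apply: eq_bigr => j _; rewrite (xiP j).2.
Qed.

Lemma segment_coord_norm p u x : (forall i, exists2 s : R, 0 <= s <= 1 & x 0 i = p 0 i + s * u 0 i) ->
  `|x - p| <= `|u|.
Proof.
move=> px; apply: norm_rV_le => // i; rewrite !mxE.
have [s /andP[s0 s1] ->] := px i.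
rewrite addrAC subrr add0r normrM (ger0_norm s0).
by apply: le_trans (coord_le_norm u i); rewrite ler_piMl.
Qed.

(** A cube is a product of intervals, so it contains the whole box spanned by two of its points,
    which a Euclidean ball need not. *)
Lemma segment_coord_cube z p q x (r : R) : 0 <= r -> `|p - z| <= r -> `|q - z| <= r ->
  (forall i, exists2 s : R, 0 <= s <= 1 & x 0 i = p 0 i + s * (q - p) 0 i) ->
  `|x - z| <= r.
Proof.
move=> r0 pz qz px; apply: norm_rV_le => // i; rewrite !mxE.
have [s /andP[s0 s1] ->] := px i; rewrite !mxE.
have := le_trans (coord_le_norm _ i) pz; have := le_trans (coord_le_norm _ i) qz.
rewrite !mxE !ler_norml => /andP[a1 a2] /andP[b1 b2]; apply/andP; split; nra.
Qed.

(** The increment of [f] along the curve expands by [MVT_coords]; the intermediate points tend to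
    [th t], and continuity of the partial derivatives gives the limit of the difference quotient. *)
Lemma is_derive_comp_curve f (th : R -> 'rV[R]_n) (t : R) (d : 'rV[R]_n) :
  Ck 1 f -> is_derive t (1 : R) th d ->
  is_derive t (1 : R) (f \o th) (\sum_(j < n) d 0 j * 'D_(ev R j) f (th t)).
Proof.
case=> _ df Df dth; apply: is_derive_cvg.
have cth := is_derive_continuous dth.
have /choice[xi xiP] : forall h : R, exists xi : 'I_n -> 'rV[R]_n,
  (forall j, `|xi j - th t| <= `|th (h *: 1 + t) - th t|) /\
  f (th (h *: 1 + t)) - f (th t) =
   \sum_(j < n) (th (h *: 1 + t) - th t) 0 j * 'D_(ev R j) f (xi j).
  move=> h; have [xi xi1 xi2] := @MVT_coords f (th t) (th (h *: 1 + t) - th t) df.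
  exists xi; split; last by rewrite -xi2 subrK.
  by move=> j; apply: segment_coord_norm.
rewrite (_ : (fun h => _) = (fun h : R => \sum_(j < n)
   (h^-1 *: (th (h *: 1 + t) - th t)) 0 j * 'D_(ev R j) f (xi h j))); last first.
  apply/funext => h; rewrite /= (xiP h).2 scaler_sumr; apply: eq_bigr => j _.
  by rewrite scalerAl !mxE.
have ct : th (h *: 1 + t) @[h --> (0 : R)^'] --> th t.
  have : (h *: 1 + t) @[h --> (0 : R)^'] --> t.
    rewrite -[X in _ --> X]add0r; apply: cvgD; last exact: cvg_cst.
    rewrite -[X in _ --> X](scale0r (1 : R)); apply: cvgZr_tmp.
    by apply: cvg_trans (@nbhs_dnbhs _ (0 : R)) _.
  by move=> ht; apply: (cvg_comp _ _ ht cth).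
apply: cvg_fsum => j; apply: cvgM.
  have := cvg_is_derive dth => /(@cvg_comp _ _ _ _ (fun M : 'rV[R]_n => M 0 j) _ _ _).
  by apply; exact: coord_continuous.
have : xi h j @[h --> (0 : R)^'] --> th t.
  apply/cvgrPdist_le => e e0; move/cvgrPdist_le: ct => /(_ e e0).
  by apply: filterS => h hth; rewrite distrC; apply: le_trans ((xiP h).1 j) _; rewrite distrC.
have cD : continuous (fun x => 'D_(ev R j) f x) := Df (ev R j).
by move=> ht; apply: (cvg_comp _ _ ht (cD (th t))).
Qed.

Lemma cube_compact p (r : R) : compact [set x : 'rV[R]_n | `|x - p| <= r].
Proof.
apply: bounded_closed_compact.
  exists (r + `|p|); split; first exact: num_real.
  move=> M rM x /= xr; apply: le_trans (ltW rM).
  by rewrite -(subrK p x); apply: le_trans (ler_normD _ _) _; rewrite lerD2r.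
apply: (@preimage_closed _ _ (fun x : 'rV[R]_n => `|x - p|) [set y | y <= r]); last exact: closed_le.
by move=> x _; exact: (@dist_continuous 'rV[R]_n p).
Qed.

Lemma continuous_cube_bounded f p (r : R) : continuous f ->
  exists2 M : R, 0 <= M & forall x, `|x - p| <= r -> `|f x| <= M.
Proof.
move=> cf; have [r0|r0] := leP 0 r; last first.
  by exists 0 => // x xr; have := le_lt_trans xr r0; rewrite ltNge normr_ge0.
have [||c _ cM] := @EVT_max_rV R n (fun x => `|f x|) [set x | `|x - p| <= r] _ (@cube_compact p r).
- by exists p => /=; rewrite subrr normr0.
- exact: (continuous_subspaceT (normr_continuous cf)).
by exists `|f c| => // x xr; apply: cM; rewrite inE.
Qed.

Lemma C1_cube_lipschitz f z (r : R) : Ck 1 f ->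
  exists2 L : R, 0 <= L & forall x y, `|x - z| <= r -> `|y - z| <= r ->
    `|f x - f y| <= L * `|x - y|.
Proof.
case=> _ df Df.
have /choice[M MP] : forall j : 'I_n, exists M : R, 0 <= M /\
    forall x, `|x - z| <= r -> `|'D_(ev R j) f x| <= M.
  by move=> j; have [M M0 MP] := @continuous_cube_bounded (fun x => 'D_(ev R j) f x) z r (Df _); exists M.
exists (\sum_j M j); first by apply: sumr_ge0 => j _; exact: (MP j).1.
move=> x y xz yz; have [xi xi1] := @MVT_coords f y (x - y) df.
rewrite subrK => ->; apply: le_trans (ler_norm_sum _ _ _) _.
rewrite mulr_suml; apply: ler_sum => j _; rewrite normrM mulrC ler_pM//; last exact: coord_le_norm.
apply: (MP j).2; apply: (segment_coord_cube _ yz xz (xi1 j)).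
exact: le_trans (normr_ge0 _) xz.
Qed.

End Vec.
End C1Calculus.

(** * Comparison of increments on the line; monotone limits at infinity *)

Section RealLine.
Variable R : realType.
Implicit Types f g : R -> R.

Lemma is_derive_comp1 f g (t a b : R) : is_derive t (1 : R) g a ->
  is_derive (g t) (1 : R) f b -> is_derive t (1 : R) (fun s => f (g s)) (b * a).
Proof.
move=> [dg Dg] [df Df].
have E : 'D_1 (fun s => f (g s)) t = b * a.
  by have := @derive1_comp R g f t dg df; rewrite !derive1E Df Dg.
rewrite -E; apply: derivableP; apply: (derivable1_diffP _ _).2.
apply: (@differentiable_comp _ _ _ _ g f).
  exact: (derivable1_diffP _ _).1 dg.
exact: (derivable1_diffP _ _).1 df.
Qed.

Lemma is_derive_expRM (c t : R) :
  is_derive t (1 : R) (fun s => expR (c * s)) (c * expR (c * t)).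
Proof.
have dg : is_derive t (1 : R) (fun s => c * s) c.
  by apply: is_derive_eq; rewrite /GRing.scale /=; ring.
by have := is_derive_comp1 dg (is_derive_expR (c * t)); rewrite mulrC.
Qed.

(** [g + f] and [g - f] have nonnegative derivatives, so both are nondecreasing. This takes the
    place of integrating [|f'| <= g']. *)
Lemma increment_le f g (f' g' : R -> R) (a b : R) : a <= b ->
  (forall t, a <= t <= b -> is_derive t (1 : R) f (f' t)) ->
  (forall t, a <= t <= b -> is_derive t (1 : R) g (g' t)) ->
  (forall t, a <= t <= b -> `|f' t| <= g' t) ->
  `|f b - f a| <= g b - g a.
Proof.
move=> ab df dg fg.
have key (h h' : R -> R) : (forall t, a <= t <= b -> is_derive t (1 : R) h (h' t)) ->
    (forall t, a <= t <= b -> 0 <= h' t) -> 0 <= h b - h a.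
  move=> dh h0.
  have [||c] := @MVT_segment R h h' a b ab.
  - by move=> x; rewrite in_itv /= => /andP[/ltW ax /ltW xb]; apply: dh; rewrite ax.
  - apply: derivable_within_continuous => x; rewrite in_itv /= => xab.
    by have [] := dh x xab.
  - by rewrite in_itv /= => cab ->; rewrite mulr_ge0 ?h0 ?subr_ge0.
have Hp : 0 <= (g b + f b) - (g a + f a).
  apply: (key (fun t => g t + f t) (fun t => g' t + f' t)) => t tab.
    by have := df t tab; have := dg t tab => ? ?; exact: is_deriveD.
  by have := fg t tab; rewrite ler_norml => /andP[]; lra.
have Hm : 0 <= (g b - f b) - (g a - f a).
  apply: (key (fun t => g t - f t) (fun t => g' t - f' t)) => t tab.
    by have := df t tab; have := dg t tab => ? ?; exact: is_deriveB.
  by have := fg t tab; rewrite ler_norml => /andP[]; lra.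
by rewrite ler_norml; apply/andP; split; lra.
Qed.

Lemma nonincreasing_bounded_cvg f (m : R) : (forall s t, 0 <= s -> s <= t -> f t <= f s) ->
  (forall t, 0 <= t -> m <= f t) -> exists l : R, f t @[t --> +oo] --> l.
Proof.
move=> f_noninc fm; pose A := [set f t | t in [set t | 0 <= t]].
have hA : has_inf A.
  by split; [exists (f 0), 0 => //=|exists m => _ [t t0 <-]; exact: fm].
exists (inf A); apply/cvgrPdist_le => e e0.
have [_ [s s0 <-] sl] := inf_adherent e0 hA.
near=> t.
have st : s <= t by near: t; by apply: nbhs_pinfty_ge; exact: num_real.
have lt : inf A <= f t.
  by apply: ge_inf; [exact: hA.2|exists t => //=; exact: le_trans st].
rewrite distrC ger0_norm ?subr_ge0// lerBlDl.
by apply: le_trans (f_noninc _ _ s0 st) _; exact: ltW.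
Unshelve. all: by end_near. Qed.

End RealLine.

(** * Trapping and convergence of gradient curves under a Lojasiewicz inequality *)

Section GradientFlow.
Variables (R : realType) (n : nat) (V : 'rV[R]_n -> R) (z : 'rV[R]_n) (r mu K : R).
Hypotheses (V1 : Ck 1 V) (V_ge0 : forall x, 0 <= V x).
Hypotheses (r_gt0 : 0 < r) (mu_gt0 : 0 < mu) (K_gt0 : 0 < K) (Kmu : K / mu < r).
Hypothesis PL : forall x, `|x - z| <= r -> 4 * mu ^+ 2 * V x <= sqnorm (grad V x).
Hypothesis Vz : V z <= K ^+ 2.
Variable th : R -> 'rV[R]_n.
Hypothesis th0 : th 0 = z.
(** The equation is assumed only while the curve is in the cube, so that solutions of the clamped
    field qualify before they are known to stay inside; [cth] keeps the curve from jumping across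
    the boundary. *)
Hypothesis dth : forall t, 0 <= t -> `|th t - z| <= r ->
  is_derive t (1 : R) th (- grad V (th t)).
Hypothesis cth : forall t, 0 <= t -> {for t, continuous th}.

(* [- Phi'] dominates the speed of the curve by AM-GM, and remains differentiable where [V] vanishes,
   unlike [Num.sqrt V]. *)
Let Phi (t : R) : R := expR ((2 * mu ^+ 2) * t) * V (th t) / (2 * mu * K) +
  K / (2 * mu) * expR (- (2 * mu ^+ 2) * t).

Let Phi' (t : R) : R := expR ((2 * mu ^+ 2) * t) / (2 * mu * K) *
    (2 * mu ^+ 2 * V (th t) - sqnorm (grad V (th t))) -
  mu * K * expR (- (2 * mu ^+ 2) * t).

Lemma coord_sqnorm_le (u : 'rV[R]_n) j : u 0 j ^+ 2 <= sqnorm u.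
Proof.
rewrite /sqnorm (bigD1 j) //= lerDl; apply: sumr_ge0 => i _; exact: sqr_ge0.
Qed.

Lemma is_derive_Phi t : 0 <= t -> `|th t - z| <= r -> is_derive t (1 : R) Phi (Phi' t).
Proof.
move=> t0 tr; have := is_derive_comp_curve V1 (dth t0 tr).
rewrite (_ : \sum_j _ = - sqnorm (grad V (th t))); last first.
  by rewrite /sqnorm -sumrN; apply: eq_bigr => j _; rewrite !mxE mulNr -expr2.
move=> dV; have de := is_derive_expRM (2 * mu ^+ 2) t.
have de' := is_derive_expRM (- (2 * mu ^+ 2)) t.
have -> : Phi = (fun s => (2 * mu * K)^-1 * (expR ((2 * mu ^+ 2) * s) * (V \o th) s) +
  K / (2 * mu) * expR (- (2 * mu ^+ 2) * s)).
  by apply/funext => s; rewrite /Phi mulrC.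
apply: is_derive_eq; rewrite /Phi' /GRing.scale /= .
by field; rewrite !gt_eqF.
Qed.

(** Let [lam = K * expR (- (2 * mu ^+ 2) * t)], the bound on the root of [V] that the decay
    [V' <= - 4 mu^2 V] imposes; then [Phi = (V / lam + lam) / (2 mu)]. The Lojasiewicz inequality
    spends at most half of [|grad V|^2] on the term in [V], and the rest,
    [|g|^2 / (4 mu lam) + mu lam], is at least [|g|] by completing the square. *)
Lemma speed_le_Phi' t j : 0 <= t -> `|th t - z| <= r -> `|(- grad V (th t)) 0 j| <= - Phi' t.
Proof.
move=> t0 tr; set g := grad V (th t).
have g2 := coord_sqnorm_le g j; have pl := PL tr; rewrite -/g in pl.
rewrite mxE normrN /Phi' -/g mulNr (expRN (2 * mu ^+ 2 * t)).
set a : R := expR _; have a0 : 0 < a by exact: expR_gt0.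
have mK : 0 < mu * K by rewrite mulr_gt0.
apply: (@le_trans _ _ (a / (2 * mu * K) * (`|g 0 j| ^+ 2 / 2) + mu * K / a)).
  have -> : a / (2 * mu * K) * (`|g 0 j| ^+ 2 / 2) + mu * K / a =
     `|g 0 j| + (a * `|g 0 j| / 2 - mu * K) ^+ 2 / (mu * K * a).
    by field; rewrite !gt_eqF.
  by rewrite lerDl divr_ge0 ?sqr_ge0// ltW// mulr_gt0.
rewrite opprB addrC lerD2l -mulrN ler_pM2l; last by rewrite divr_gt0// !mulr_gt0.
rewrite -normrX ger0_norm ?sqr_ge0//; lra.
Qed.

Lemma displacement_le_Phi s t j : 0 <= s -> s <= t ->
  (forall u, 0 <= u <= t -> `|th u - z| <= r) ->
  `|th t 0 j - th s 0 j| <= Phi s - Phi t.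
Proof.
move=> s0 st inr.
have H := @increment_le R (fun u => th u 0 j) (fun u => - Phi u)
   (fun u => (- grad V (th u)) 0 j) (fun u => - Phi' u) s t st.
rewrite [Phi s - _]addrC -[Phi s]opprK; apply: H => u /andP[su ut].
- have u0 := le_trans s0 su.
  exact: is_derive_mxcoord (dth u0 (inr u (introT andP (conj u0 ut)))).
- have u0 := le_trans s0 su.
  by have := is_derive_Phi u0 (inr u (introT andP (conj u0 ut))) => ?; exact: is_deriveN.
- have u0 := le_trans s0 su.
  exact: speed_le_Phi' u0 (inr u (introT andP (conj u0 ut))).
Qed.

(** [displacement_le_Phi] would give this through any coordinate, but for [n = 0] there is none; the
    comparison is therefore made with a constant function. *)
Lemma Phi_nonincreasing s t : 0 <= s -> s <= t ->
  (forall u, 0 <= u <= t -> `|th u - z| <= r) -> Phi t <= Phi s.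
Proof.
move=> s0 st inr.
have H := @increment_le R (fun=> 0) (fun u => - Phi u) (fun=> 0) (fun u => - Phi' u) s t st.
have {H} : `|0 - 0 : R| <= - Phi t - - Phi s.
  apply: H => u /andP[su ut].
  - have u0 := le_trans s0 su.
    by have := is_derive_Phi u0 (inr u (introT andP (conj u0 ut))) => ?; exact: is_deriveN.
  - have u0 := le_trans s0 su; rewrite normr0 /Phi' mulNr opprB addr_ge0 //.
      by rewrite !mulr_ge0 ?expR_ge0// ltW.
    have pl := PL (inr u (introT andP (conj u0 ut))).
    rewrite -mulrN mulr_ge0 ?divr_ge0 ?expR_ge0// ?mulr_ge0 ?(ltW mu_gt0) ?(ltW K_gt0)//.
    rewrite opprB subr_ge0; apply: le_trans pl; rewrite ler_wpM2r//.
    by rewrite ler_wpM2r ?sqr_ge0// ler_nat.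
by rewrite subrr normr0 opprK addrC subr_ge0.
Qed.

Lemma Phi_ge0 t : 0 <= Phi t.
Proof.
by rewrite addr_ge0// ?mulr_ge0 ?expR_ge0 ?invr_ge0 ?mulr_ge0 ?(ltW mu_gt0) ?(ltW K_gt0).
Qed.

Lemma Phi0_le : Phi 0 <= K / mu.
Proof.
rewrite /Phi !mulr0 expR0 th0 mul1r mulr1.
rewrite (_ : K / mu = K ^+ 2 / (2 * mu * K) + K / (2 * mu)); last by field; rewrite !gt_eqF.
by rewrite lerD2r ler_pM2r// invr_gt0 !mulr_gt0.
Qed.

Lemma displacement_le t : 0 <= t -> (forall u, 0 <= u <= t -> `|th u - z| <= r) ->
  `|th t - z| <= K / mu.
Proof.
move=> t0 inr; apply: norm_rV_le => [|j]; first by rewrite divr_ge0// ltW.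
rewrite !mxE -th0; apply: le_trans (displacement_le_Phi j (lexx 0) t0 inr) _.
by have := Phi_ge0 t; have := Phi0_le; lra.
Qed.

(** First exit: at the infimum [s] of the times [u] with [r <= d u], continuity gives [d s = r]. All
    earlier points lie inside, so [displacement_le] bounds [d s] by [K / mu < r], a
    contradiction. *)
Lemma flow_trapped t : 0 <= t -> `|th t - z| <= r.
Proof.
move=> t0; rewrite leNgt; apply/negP => rt.
pose d s := `|th s - z|.
have cd s : 0 <= s -> {for s, continuous d}.
  move=> s0; apply: (@continuous_comp _ _ _ th (fun x => `|x - z|)); first exact: cth.
  exact: dist_continuous.
pose A := [set s | 0 <= s /\ r <= d s].
have hA : has_inf A.
  by split; [exists t; split => //; exact: ltW|exists 0 => s []].
pose s := inf A.
have s0 : 0 <= s by apply: lb_le_inf; [exact: hA.1|move=> u []].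
have below u : 0 <= u -> u < s -> d u < r.
  move=> u0 us; rewrite ltNge; apply/negP => ru.
  by have := ge_inf hA.2 (conj u0 ru); rewrite leNgt us.
have ds_ge : r <= d s.
  rewrite leNgt; apply/negP => dsr.
  have := cd s s0 => /cvgrPdist_lt /(_ (r - d s)); rewrite subr_gt0 => /(_ dsr).
  rewrite -nbhs_nearE => /nbhs_ballP[e /= e0 eP].
  have [u [u0 ru] us] := inf_adherent e0 hA.
  have su : s <= u by by apply: (ge_inf hA.2).
  have /= := eP u; rewrite /ball /= ltr_norml ltr_norml => /(_ _)/andP.
  have -> : (- e < s - u) && (s - u < e) by apply/andP; split; lra.
  by case => //; lra.
(* [displacement_le] asks for the closed cube at time [s] itself as well; were [d s] larger than
   [r], points just before [s] would already be outside. *)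
have ds_le : d s <= r.
  have [s_eq0|s_neq0] := eqVneq s 0; first by rewrite /d s_eq0 th0 subrr normr0 ltW.
  have s_gt0 : 0 < s by rewrite lt_def s_neq0.
  rewrite leNgt; apply/negP => rds.
  have := cd s s0 => /cvgrPdist_lt /(_ (d s - r)); rewrite subr_gt0 => /(_ rds).
  rewrite -nbhs_nearE => /nbhs_ballP[e /= e0 eP].
  pose u := s - Num.min e s / 2.
  have m0 : 0 < Num.min e s by rewrite lt_min e0.
  have me : Num.min e s <= e by rewrite ge_min lexx.
  have ms : Num.min e s <= s by rewrite ge_min lexx orbT.
  have us : u < s by rewrite /u; lra.
  have u0 : 0 <= u by rewrite /u; lra.
  have du := below u u0 us.
  have /= := eP u; rewrite /ball /= ltr_norml ltr_norml => /(_ _)/andP.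
  have -> : (- e < s - u) && (s - u < e) by apply/andP; split; rewrite /u; lra.
  by case => //; lra.
have : d s <= K / mu.
  apply: displacement_le => // u /andP[u0]; rewrite le_eqVlt => /predU1P[->//|us].
  exact/ltW/below.
by move=> dK; have := le_lt_trans dK Kmu; rewrite ltNge ds_ge.
Qed.

(** [Phi t] and [Phi t + th t 0 j] are both nonincreasing and bounded below, so each coordinate
    converges as a difference of two monotone limits. The limit is a zero of [V] because
    [Phi t <= K / mu] forces [V (th t) <= 2 K^2 expR (- 2 mu^2 t)]. *)
Lemma flow_cvg : exists ths : 'rV[R]_n,
  [/\ th t @[t --> +oo] --> ths, V ths = 0 & forall j, `|ths 0 j - z 0 j| <= K / mu].
Proof.
have inr u t : 0 <= u <= t -> `|th u - z| <= r by case/andP => /flow_trapped.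
have dPhi s t j : 0 <= s -> s <= t -> `|th t 0 j - th s 0 j| <= Phi s - Phi t.
  by move=> s0 st; apply: displacement_le_Phi => // u; exact: inr.
have Phi_noninc s t : 0 <= s -> s <= t -> Phi t <= Phi s.
  by move=> s0 st; apply: Phi_nonincreasing => // u; exact: inr.
have [l Phil] := nonincreasing_bounded_cvg Phi_noninc (fun t _ => Phi_ge0 t).
have thl j : exists l : R, th t 0 j @[t --> +oo] --> l.
  have [|t t0|l' thPhi] := @nonincreasing_bounded_cvg R (fun t => Phi t + th t 0 j) (z 0 j - r).
  - by move=> s t s0 st; have := dPhi s t j s0 st; rewrite ler_norml => /andP[]; lra.
  - have := le_trans (coord_le_norm _ j) (flow_trapped t0); rewrite !mxE ler_norml => /andP[].
    by have := Phi_ge0 t; lra.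
  exists (l' - l); apply: cvg_trans (cvgB thPhi Phil); apply: near_eq_cvg.
  by near=> t; rewrite /= addrAC subrr add0r.
have [lj ljP] := choice thl.
pose ths : 'rV[R]_n := \row_j lj j.
have th_cvg : th t @[t --> +oo] --> ths.
  apply/cvgrPdist_le => e e0.
  have : \forall t \near +oo, forall j, `|lj j - th t 0 j| <= e.
    by apply: filter_forall => j; exact: ((cvgrPdist_le _ _).1 (ljP j)).
  by apply: filterS => t H; apply: norm_rV_le (ltW e0) _ => j; rewrite !mxE.
exists ths; split => //.
- have cV : continuous V := Ck_continuous V1.
  have VthV : V (th t) @[t --> +oo] --> V ths by apply: (cvg_comp _ _ th_cvg (cV ths)).
  suff V0 : V (th t) @[t --> +oo] --> (0 : R) by exact: (cvg_unique _ VthV V0).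
  have up : 2 * K ^+ 2 * expR (- (2 * mu ^+ 2) * t) @[t --> +oo] --> (0 : R).
    rewrite -[X in _ --> X](mulr0 (2 * K ^+ 2)); apply: cvgMr.
    have ct : (2 * mu ^+ 2) * t @[t --> +oo] --> +oo.
      apply/cvgryPge => A; near=> t.
      rewrite mulrC -ler_pdivrMr; last by rewrite mulr_gt0 ?exprn_gt0.
      by near: t; apply: nbhs_pinfty_ge; exact: num_real.
    apply: cvg_trans (cvg_comp _ _ ct (@cvgr_expR R)); apply: near_eq_cvg.
    by near=> t; rewrite /= mulNr.
  apply: (@squeeze_cvgr _ _ _ _ (fun=> 0) (fun t => 2 * K ^+ 2 * expR (- (2 * mu ^+ 2) * t))) => //.
    near=> t; rewrite V_ge0 /=.
    have t0 : 0 <= t by near: t; apply: nbhs_pinfty_ge; exact: num_real.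
    have := le_trans (Phi_noninc 0 t (lexx 0) t0) Phi0_le.
    rewrite /Phi mulNr expRN; set a : R := expR _; have a0 : 0 < a by exact: expR_gt0.
    move=> H; have : a * V (th t) / (2 * mu * K) <= K / mu.
      apply: le_trans H; rewrite lerDl mulr_ge0 ?invr_ge0 ?(ltW a0)//.
      by rewrite divr_ge0 ?mulr_ge0 ?(ltW mu_gt0) ?(ltW K_gt0).
    rewrite ler_pdivrMr ?mulr_gt0// => H'.
    rewrite ler_pdivlMr// mulrC; apply: le_trans H' _.
    by rewrite le_eqVlt; apply/orP; left; apply/eqP; field; rewrite gt_eqF.
  exact: cvg_cst.
- move=> j; rewrite mxE.
  have d_cvg : `|th t 0 j - z 0 j| @[t --> +oo] --> `|lj j - z 0 j|.
    by apply: cvg_norm; apply: cvgB; [exact: ljP|exact: cvg_cst].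
  rewrite -(cvg_lim _ d_cvg)//; apply: limr_le; first by apply/cvg_ex; eexists; exact: d_cvg.
  near=> t.
  have t0 : 0 <= t by near: t; apply: nbhs_pinfty_ge; exact: num_real.
  rewrite -th0; apply: le_trans (dPhi 0 t j (lexx 0) t0) _.
  by have := Phi_ge0 t; have := Phi0_le; lra.
Unshelve. all: by end_near. Qed.

End GradientFlow.

(** * Global solutions of Lipschitz differential equations by Picard iteration *)

Section ODE.
Variable R : realType.

Lemma lipschitz_comp_continuous (T : topologicalType) (U W : normedModType R)
    (F : U -> W) (y : T -> U) (L : R) :
  (forall a b, `|F a - F b| <= L * `|a - b|) -> continuous y -> continuous (fun t => F (y t)).
Proof.
move=> FL cy t; apply/cvgrPdist_le => e e0.
have L1 : 0 < `|L| + 1 by rewrite ltr_wpDl.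
have := cy t => /cvgrPdist_le /(_ _ (divr_gt0 e0 L1)); apply: filterS => s ts.
apply: le_trans (FL _ _) _; rewrite ler_pdivlMr// in ts; apply: le_trans ts.
by rewrite mulrC ler_wpM2l//; apply: le_trans (ler_norm L) _; rewrite lerDl.
Qed.

Lemma derive1_is_derive (f : R -> R) (t l : R) : derivable f t 1 -> f^`()%classic t = l ->
  is_derive t (1 : R) f l.
Proof. by move=> df <-; rewrite derive1E; exact: derivableP. Qed.

Lemma continuous_primitive (g : R -> R) : continuous g ->
  exists P : R -> R, P 0 = 0 /\ forall t : R, 0 <= t -> is_derive t (1 : R) P (g t).
Proof.
(* Starting at [-1] makes [0] an interior point of the interval, so the derivative at [0] is
   two-sided. *)
move=> cg; pose F x := (\int[@lebesgue_measure R]_(t in [set` `[-1, x]]) g t)%R.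
exists (fun x => F x - F 0); split; first by rewrite subrr.
move=> t t0.
have gi : (@lebesgue_measure R).-integrable `[-1, t + 1] (EFin \o g).
  by apply: continuous_compact_integrable; [exact: segment_compact|exact: continuous_subspaceT].
have t1 : t < t + 1 by rewrite ltrDl.
have t2 : -1 < t by apply: lt_le_trans t0; rewrite ltrN10.
have [dF DF] := continuous_FTC1_closed t1 gi t2 (cg t).
have dF' := derive1_is_derive dF DF.
by apply: is_derive_eq; rewrite subr0.
Qed.

Lemma continuous_primitive_row n (g : R -> 'rV[R]_n) : continuous g ->
  exists P : R -> 'rV[R]_n, P 0 = 0 /\ forall t : R, 0 <= t -> is_derive t (1 : R) P (g t).
Proof.
move=> cg.
have /choice[P PP] (j : 'I_n) : exists P : R -> R, P 0 = 0 /\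
    forall t : R, 0 <= t -> is_derive t (1 : R) P (g t 0 j).
  by apply: continuous_primitive; exact: (@Ck_mxcoord R _ _ _ 0 g).
exists (fun t => \row_j P j t); split; first by apply/rowP => j; rewrite !mxE (PP j).1.
move=> t t0; apply: is_derive_row => j.
by under eq_fun do rewrite mxE; exact: (PP j).2.
Qed.

(* [u k - 2 D / 2 ^ k] is nondecreasing and [u k + 2 D / 2 ^ k] nonincreasing. *)
Lemma geometric_cauchy_limit (u : nat -> R) (D : R) : 0 <= D ->
  (forall k, `|u k.+1 - u k| <= D / 2 ^+ k) ->
  exists l : R, forall k, `|u k - l| <= 2 * D / 2 ^+ k.
Proof.
move=> D0 uD.
pose d k := D / 2 ^+ k.
have dS k : 2 * d k.+1 = d k by rewrite /d exprS; field; rewrite expf_neq0.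
have d0 k : 0 <= d k by rewrite divr_ge0// exprn_ge0.
pose v k := u k - 2 * d k; pose w k := u k + 2 * d k.
have vS k : v k <= v k.+1.
  by have := uD k; rewrite -/(d k) ler_norml /v -(dS k) => /andP[]; lra.
have wS k : w k.+1 <= w k.
  by have := uD k; rewrite -/(d k) ler_norml /w -(dS k) => /andP[]; lra.
have vm k p : v k <= v (k + p)%N.
  by elim: p => [|p IH]; rewrite ?addn0// addnS; exact: le_trans IH (vS _).
have wm k p : w (k + p)%N <= w k.
  by elim: p => [|p IH]; rewrite ?addn0// addnS; exact: le_trans (wS _) IH.
have vw k p : v k <= w p.
  apply: le_trans (vm k p) _; apply: (@le_trans _ _ (w (p + k)%N)); last exact: wm.
  by rewrite addnC /v /w; have := d0 (p + k)%N; lra.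
have hs : has_sup [set v k | k in setT].
  by split; [exists (v 0%N), 0%N|exists (w 0%N) => _ [k _ <-]; exact: vw].
exists (sup [set v k | k in setT]) => k.
have h1 : v k <= sup [set v k | k in setT] by apply: ub_le_sup; [exact: hs.2|exists k].
have h2 : sup [set v k | k in setT] <= w k.
  by apply: ge_sup; [exact: hs.1|move=> _ [p _ <-]; exact: vw].
by rewrite ler_norml -mulrA -/(d k); move: h1 h2; rewrite /v /w; move=> h1 h2; apply/andP; split; lra.
Qed.

Lemma exp2_small (D e : R) : 0 < e -> exists k : nat, D / 2 ^+ k <= e.
Proof.
move=> e0; exists (Num.bound (D / e)).
rewrite ler_pdivrMr ?exprn_gt0// mulrC -ler_pdivrMr//.
by apply/ltW/upper_nthrootP.
Qed.

Lemma exp2_le0 (D a : R) : (forall k : nat, a <= D / 2 ^+ k) -> a <= 0.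
Proof.
move=> aD; rewrite leNgt; apply/negP => a0.
have [k De] := exp2_small D (divr_gt0 a0 (ltr0Sn _ 1)).
by have := le_trans (aD k) De; lra.
Qed.

Section Picard.
Variables (n : nat) (F : 'rV[R]_n -> 'rV[R]_n) (L : R) (z : 'rV[R]_n).
Hypotheses (L_gt0 : 0 < L) (FL : forall a b, `|F a - F b| <= L * `|a - b|).

(** [2 * L * expR (2 * L * s)] is the derivative of [expR (2 * L * s)]. Measured against this
    weight, integrating an [L]-Lipschitz field halves distances, whatever the length of the time
    interval. *)
Lemma row_increment_le (f g f' g' : R -> 'rV[R]_n) (D t : R) : 0 <= t -> 0 <= D -> f 0 = g 0 ->
  (forall s : R, 0 <= s -> is_derive s (1 : R) f (f' s)) ->
  (forall s : R, 0 <= s -> is_derive s (1 : R) g (g' s)) ->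
  (forall s : R, 0 <= s -> `|f' s - g' s| <= D * (2 * L * expR (2 * L * s))) ->
  `|f t - g t| <= D * expR (2 * L * t).
Proof.
move=> t0 D0 fg0 df dg fg; apply: norm_rV_le => [|j]; first by rewrite mulr_ge0// expR_ge0.
rewrite !mxE.
have H := @increment_le R (fun s => f s 0 j - g s 0 j) (fun s => D * expR (2 * L * s))
   (fun s => f' s 0 j - g' s 0 j) (fun s => D * (2 * L * expR (2 * L * s))) 0 t t0.
have {H} : `|(f t 0 j - g t 0 j) - (f 0 0 j - g 0 0 j)| <=
    D * expR (2 * L * t) - D * expR (2 * L * 0).
  apply: H => s /andP[s0 _].
  - have := is_derive_mxcoord 0 j (df s s0); have := is_derive_mxcoord 0 j (dg s s0) => ? ?.
    exact: is_deriveB.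
  - have de := is_derive_expRM (2 * L) s.
    by apply: is_derive_eq; rewrite /GRing.scale /=; ring.
  - apply: le_trans (fg s s0); apply: le_trans (coord_le_norm _ j).
    by rewrite !mxE.
rewrite fg0 subrr subr0 => H; apply: le_trans H _.
by rewrite lerBlDr lerDl mulr_ge0 ?expR_ge0.
Qed.

(** Since the weighted steps between iterates halve each time, the iterates converge on the whole
    half-line at once, without gluing local solutions. *)
Lemma lipschitz_ode_exists : exists y : R -> 'rV[R]_n, y 0 = z /\
  forall t : R, 0 <= t -> is_derive t (1 : R) y (F (y t)).
Proof.
have [P PP] : {P : (R -> 'rV[R]_n) -> R -> 'rV[R]_n & forall g, continuous g ->
    P g 0 = 0 /\ forall t : R, 0 <= t -> is_derive t (1 : R) (P g) (g t)}.
  apply: (@choice _ _ (fun g P => continuous g -> P 0 = 0 /\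
    forall t : R, 0 <= t -> is_derive t (1 : R) P (g t))) => g.
  have [/continuous_primitive_row[P HP]|ng] := pselect (continuous g); first by exists P.
  by exists g.
(* [`|t|] extends the iterates, controlled for [0 <= t] only, to continuous functions on the line. *)
pose T (y : R -> 'rV[R]_n) (t : R) := z + P (fun s => F (y s)) `|t|.
pose y k := iter k T (fun=> z).
have cF (x : R -> 'rV[R]_n) : continuous x -> continuous (fun s => F (x s)).
  exact: lipschitz_comp_continuous.
have dT x : continuous x -> forall t : R, 0 <= t ->
    is_derive t (1 : R) (fun t => z + P (fun s => F (x s)) t) (F (x t)).
  move=> cx t t0; have := (PP _ (cF x cx)).2 t t0 => ?.
  by apply: is_derive_eq; rewrite add0r.
have cT x : continuous x -> continuous (T x).
  move=> cx t; apply: (@continuous_comp _ _ _ (fun t : R => `|t|)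
      (fun t => z + P (fun s => F (x s)) t)); first exact: norm_continuous.
  by apply: is_derive_continuous; exact: dT.
have cy k : continuous (y k).
  by elim: k => [|k IH]; [move=> t; exact: cvg_cst|exact: cT].
have T0 x : continuous x -> z + P (fun s => F (x s)) 0 = z.
  by move=> cx; rewrite (PP _ (cF x cx)).1 addr0.
have yabs k t : y k t = y k `|t| by case: k => //= k; rewrite /T normr_id.
(* The first iterate leaves the constant [z] with speed [|F z|], which is [2 * L * C]. *)
pose C := `|F z| / (2 * L).
have C0 : 0 <= C by rewrite divr_ge0// mulr_ge0// ltW.
have step k t : 0 <= t -> `|y k.+1 t - y k t| <= C / 2 ^+ k * expR (2 * L * t).
  elim: k t => [|k IH] t t0.
    rewrite /= /T ger0_norm//.
    apply: (row_increment_le t0 _ (T0 _ (cy 0%N)) (dT _ (cy 0%N)) (fun s _ => is_derive_cst z s (1 : R))).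
      by rewrite expr0 divr1.
    move=> s s0; rewrite subr0 expr0 divr1 /C /=.
    rewrite (_ : _ * (2 * L * expR _) = `|F z| * expR (2 * L * s)); last by field; rewrite gt_eqF.
    by rewrite ler_peMr// -expR0 ler_expR !mulr_ge0// ltW.
  rewrite [y k.+2]/= [y k.+1]/= -/(y k) -/(y k.+1) /T ger0_norm//.
  apply: (row_increment_le t0 _ _ (dT _ (cy k.+1)) (dT _ (cy k))).
  - by rewrite divr_ge0// exprn_ge0.
  - by rewrite (T0 _ (cy k.+1)) (T0 _ (cy k)).
  - move=> s s0; apply: le_trans (FL _ _) _.
    rewrite (_ : _ * (2 * L * _) = L * (C / 2 ^+ k * expR (2 * L * s))).
      by rewrite ler_pM2l//; exact: IH.
    rewrite exprS; have : 2 ^+ k != 0 :> R by rewrite expf_neq0.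
    by move: (2 ^+ k) (expR _) (C) => q e c q0; field; rewrite q0.
have lim t : exists l : 'rV[R]_n, forall k, `|y k t - l| <= 2 * (C * expR (2 * L * `|t|)) / 2 ^+ k.
  have [l lP] : {l : 'I_n -> R & forall j, forall k,
      `|y k t 0 j - l j| <= 2 * (C * expR (2 * L * `|t|)) / 2 ^+ k}.
    apply: (@choice _ _ (fun j l => forall k,
      `|y k t 0 j - l| <= 2 * (C * expR (2 * L * `|t|)) / 2 ^+ k)) => j.
    apply: geometric_cauchy_limit => [|k]; first by rewrite mulr_ge0// expR_ge0.
    rewrite mulrAC; apply: le_trans (step k _ (normr_ge0 t)).
    by rewrite -!yabs; apply: le_trans (coord_le_norm _ j); rewrite !mxE.
  exists (\row_j l j) => k; apply: norm_rV_le => [|j]; last by rewrite !mxE.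
  by rewrite divr_ge0 ?exprn_ge0// mulr_ge0// mulr_ge0 ?expR_ge0.
have [x xP] := choice lim.
have cx : continuous x.
  move=> t; apply/cvgrPdist_le => e e0.
  have e3 : 0 < e / 3 by rewrite divr_gt0.
  (* The error bound is uniform on bounded intervals only; [|t| + 1] covers a unit neighbourhood of
     [t]. *)
  pose D := 2 * (C * expR (2 * L * (`|t| + 1))).
  have [k kD] := exp2_small D e3.
  have near_le s : `|s| <= `|t| + 1 -> `|y k s - x s| <= e / 3.
    move=> st; apply: le_trans (xP s k) _; apply: le_trans kD.
    rewrite ler_pM2r ?invr_gt0 ?exprn_gt0// ler_pM2l// ler_wpM2l// ler_expR.
    by rewrite ler_pM2l// mulr_gt0.
  near=> s.
  have st : `|s| <= `|t| + 1.
    rewrite -lerBlDl; apply: le_trans (lerB_dist _ _) _; rewrite distrC.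
    by near: s; exact: ((cvgrPdist_le _ _).1 (@cvg_id _ (nbhs t)) 1 ltr01).
  have ys : `|y k t - y k s| <= e / 3.
    by near: s; exact: ((cvgrPdist_le _ _).1 (cy k t) _ e3).
  have -> : x t - x s = (x t - y k t) + (y k t - y k s) + (y k s - x s).
    by rewrite -!addrA (addKr (y k t)) (addKr (y k s)).
  apply: le_trans (ler_normD _ _) _; apply: le_trans (lerD (ler_normD _ _) (lexx _)) _.
  have := near_le s st; have := near_le t; rewrite lerDl ler01 distrC => /(_ isT).
  by move: ys; lra.
(* The limit [x] is even in [t], so in general it has a corner at [0]; the witness drops the
   absolute value, which leaves it equal to [x] for [0 <= t] and differentiable at [0]. *)
exists (fun t => z + P (fun s => F (x s)) t); split; first exact: T0.
move=> t t0; suff -> : z + P (fun s => F (x s)) t = x t by exact: dT.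
pose E := C * expR (2 * L * t).
apply/eqP; rewrite -subr_eq0 -normr_le0; apply: (@exp2_le0 (2 * E)) => k.
have h1 := xP t k.+1; rewrite (ger0_norm t0) -/E in h1.
have h2 : `|y k.+1 t - (z + P (fun s => F (x s)) t)| <= C / 2 ^+ k * expR (2 * L * t).
  rewrite /= /T ger0_norm//.
  apply: (row_increment_le t0 _ _ (dT _ (cy k)) (dT _ cx)).
  - by rewrite divr_ge0// exprn_ge0.
  - by rewrite (T0 _ (cy k)) (T0 _ cx).
  - move=> s s0; apply: le_trans (FL _ _) _.
    rewrite (_ : _ * (2 * L * _) = L * (2 * (C * expR (2 * L * s)) / 2 ^+ k)).
      by rewrite ler_pM2l//; have := xP s k; rewrite (ger0_norm s0).
    by field; rewrite expf_neq0.
have -> : z + P (fun s => F (x s)) t - x t =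
   (y k.+1 t - x t) - (y k.+1 t - (z + P (fun s => F (x s)) t)).
  by rewrite opprB [RHS]addrC subrKA.
apply: le_trans (ler_normB _ _) _.
apply: le_trans (lerD h1 h2) _.
rewrite le_eqVlt; apply/orP; left; apply/eqP; rewrite /E exprS; field.
by rewrite expf_neq0.
Unshelve. all: by end_near. Qed.

End Picard.
End ODE.

(** * Existence of the gradient flow through the field clamped to a cube *)

Lemma clamp_real_le (R : realDomainType) (c d x y : R) :
  `|Num.max c (Num.min d x) - Num.max c (Num.min d y)| <= `|x - y|.
Proof.
have h1 := ler_norm (x - y); have h2 := ler_norm (- (x - y)); rewrite normrN in h2.
rewrite (ler_norml (Num.max _ _ - _)).
by case: (leP d x) => ?; case: (leP d y) => ?; case: (leP c d) => ?;
  case: (leP c x) => ?; case: (leP c y) => ?; apply/andP; split; lra.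
Qed.

Section GradientFlowExistence.
Variables (R : realType) (n : nat) (V : 'rV[R]_n -> R) (z : 'rV[R]_n) (r mu K : R).
Hypotheses (V2 : Ck 2 V) (V_ge0 : forall x, 0 <= V x).
Hypotheses (r_gt0 : 0 < r) (mu_gt0 : 0 < mu) (K_gt0 : 0 < K) (Kmu : K / mu < r).
Hypothesis PL : forall x : 'rV[R]_n, `|x - z| <= r -> 4 * mu ^+ 2 * V x <= sqnorm (grad V x).
Hypothesis Vz : V z <= K ^+ 2.

Let clamp (x : 'rV[R]_n) : 'rV[R]_n :=
  \row_j Num.max (z 0 j - r) (Num.min (z 0 j + r) (x 0 j)).

Lemma clamp_cube x : `|clamp x - z| <= r.
Proof.
apply: norm_rV_le => [|j]; first exact: ltW.
rewrite !mxE ler_norml; apply/andP; split.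
  by rewrite lerBrDl le_max lexx.
by rewrite lerBlDl ge_max ge_min lexx andbT lerD2l; have := r_gt0; lra.
Qed.

Lemma clamp_id x : `|x - z| <= r -> clamp x = x.
Proof.
move=> xr; apply/rowP => j; rewrite mxE.
have := le_trans (coord_le_norm _ j) xr; rewrite !mxE ler_norml => /andP[h1 h2].
by rewrite min_r ?max_r//; lra.
Qed.

Lemma clamp_le a b : `|clamp a - clamp b| <= `|a - b|.
Proof.
apply: norm_rV_le => // j.
apply: le_trans (coord_le_norm _ j).
rewrite !mxE; exact: clamp_real_le.
Qed.

(** The gradient of a [Ck 2] function is Lipschitz on the cube; composition with the nonexpansive
    retraction [clamp] makes it Lipschitz everywhere. The [+ 1] keeps the constant positive. *)
Lemma clamped_gradient_lipschitz : exists2 L : R, 0 < L &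
  forall a b, `|- grad V (clamp a) - - grad V (clamp b)| <= L * `|a - b|.
Proof.
have /choice[L LP] : forall j : 'I_n, exists L : R, 0 <= L /\
    forall x y, `|x - z| <= r -> `|y - z| <= r ->
    `|'D_(ev R j) V x - 'D_(ev R j) V y| <= L * `|x - y|.
  move=> j; have [_ _ DV] := V2.
  by have [L L0 LP] := C1_cube_lipschitz z r (DV (ev R j)); exists L.
have L0 : 0 <= \sum_j L j by apply: sumr_ge0 => j _; exact: (LP j).1.
exists (\sum_j L j + 1); first by rewrite ltr_wpDl.
move=> a b; apply: norm_rV_le => [|j]; first by rewrite mulr_ge0// addr_ge0.
rewrite !mxE opprK addrC distrC distrC; apply: le_trans ((LP j).2 _ _ (clamp_cube _) (clamp_cube _)) _.
rewrite distrC; apply: ler_pM => //; [exact: (LP j).1| |exact: clamp_le].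
rewrite (bigD1 j)//= -addrA lerDl addr_ge0// sumr_ge0// => i _; exact: (LP i).1.
Qed.

(** A solution of the clamped equation obeys the true one wherever it lies in the cube, since
    [clamp] is the identity there; [flow_trapped] then confines it to the cube for all [0 <= t]. *)
Lemma grad_flow_exists : exists th, grad_flow V z th.
Proof.
have [L L0 FL] := clamped_gradient_lipschitz.
have [th [th0 dth]] := lipschitz_ode_exists z L0 FL.
exists th; split => // t t0.
have tr : `|th t - z| <= r.
  apply: (@flow_trapped _ _ V z r mu K) => //; first exact: CkW.
  - by move=> s s0 sr; rewrite -[X in grad V X](clamp_id sr); exact: dth.
  - by move=> s s0; exact: is_derive_continuous (dth s s0).
by rewrite -[X in grad V X](clamp_id tr); exact: dth.
Qed.

Lemma grad_flow_cvg th : grad_flow V z th -> exists ths : 'rV[R]_n,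
  [/\ th t @[t --> +oo] --> ths, V ths = 0 & forall j, `|ths 0 j - z 0 j| <= K / mu].
Proof.
move=> [th0 dth].
apply: (@flow_cvg _ _ V z r mu K) => //; first exact: CkW.
- by move=> s s0 _; exact: dth.
- by move=> s s0; exact: is_derive_continuous (dth s s0).
Qed.

End GradientFlowExistence.

(** * Sup norm against Euclidean norm, and matrices acting on rows *)

Section RowBounds.
Variable R : realType.

Lemma is_derive_fsum (V : normedModType R) (I : Type) (s : seq I) (f : I -> V -> R)
    (x u : V) (l : I -> R) :
  (forall i, is_derive x u (f i) (l i)) ->
  is_derive x u (fun y => \sum_(i <- s) f i y) (\sum_(i <- s) l i).
Proof.
move=> fl; elim: s => [|i s IH].
  rewrite big_nil; under eq_fun do rewrite big_nil.
  exact: (is_derive_cst (0 : R) x u).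
rewrite big_cons; under eq_fun do rewrite big_cons.
by have := fl i => ?; exact: is_deriveD.
Qed.

Variable n : nat.
Implicit Types u : 'rV[R]_n.

Lemma mulmx_norm_le u (Q : 'M[R]_n) (C : R) : 0 <= C -> (forall i j, `|Q i j| <= C) ->
  `|u *m Q| <= n%:R * C * `|u|.
Proof.
move=> C0 QC; apply: norm_rV_le => [|j]; first by rewrite !mulr_ge0.
rewrite mxE; apply: le_trans (ler_norm_sum _ _ _) _.
have -> : n%:R * C * `|u| = \sum_(i < n) (`|u| * C).
  by rewrite sumr_const card_ord -mulr_natl; ring.
apply: ler_sum => i _; rewrite normrM ler_pM//; exact: coord_le_norm.
Qed.

Lemma sqnorm_ge0 u : 0 <= sqnorm u.
Proof. by apply: sumr_ge0 => i _; exact: sqr_ge0. Qed.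

Lemma sqnorm_eq0 u : sqnorm u = 0 -> u = 0.
Proof.
move=> /eqP; rewrite psumr_eq0 => [/allP u0|i _]; last exact: sqr_ge0.
apply/rowP => j; rewrite mxE; apply/eqP.
by rewrite -sqrf_eq0; exact: (u0 j (mem_index_enum j)).
Qed.

Lemma norm_le_sqnorm u : `|u| ^+ 2 <= sqnorm u.
Proof.
rewrite -[leRHS]sqr_sqrtr ?sqnorm_ge0// ler_sqr ?nnegrE ?sqrtr_ge0//.
apply: norm_rV_le => [|j]; first exact: sqrtr_ge0.
by rewrite -sqrtr_sqr ler_sqrt ?sqnorm_ge0// coord_sqnorm_le.
Qed.

Lemma sqnorm_le_norm u (C : R) : (forall j, `|u 0 j| <= C) -> sqnorm u <= n%:R * C ^+ 2.
Proof.
move=> uC; have -> : n%:R * C ^+ 2 = \sum_(i < n) C ^+ 2.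
  by rewrite sumr_const card_ord mulr_natl.
apply: ler_sum => j _; rewrite -(real_normK (num_real (u 0 j))).
by rewrite ler_sqr ?nnegrE ?normr_ge0// (le_trans (normr_ge0 _) (uC j)).
Qed.

Lemma sqnorm_le_sum u : sqnorm u <= (\sum_j `|u 0 j|) ^+ 2.
Proof.
rewrite expr2 mulr_suml; apply: ler_sum => j _.
rewrite -(real_normK (num_real (u 0 j))) expr2 ler_wpM2l//.
by rewrite (bigD1 j)//= lerDl sumr_ge0.
Qed.

Lemma unitmx_norm_le (N : 'M[R]_n) : N \in unitmx ->
  exists2 a : R, 0 < a & forall u, `|u| <= a * `|u *m N|.
Proof.
move=> Nu; pose C := \sum_i \sum_j `|invmx N i j|.
have C0 : 0 <= C by apply: sumr_ge0 => i _; apply: sumr_ge0.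
have NC i j : `|invmx N i j| <= C.
  rewrite /C (bigD1 i)//= (bigD1 j)//= -addrA lerDl addr_ge0//; first exact: sumr_ge0.
  by apply: sumr_ge0 => k _; exact: sumr_ge0.
exists (n%:R * C + 1) => [|u]; first by rewrite ltr_wpDl// mulr_ge0.
rewrite -{1}(mulmxK Nu u); apply: le_trans (mulmx_norm_le _ C0 NC) _.
by rewrite ler_wpM2r// lerDl.
Qed.

End RowBounds.

(** * Zeros of a map dominated by [A / al], uniformly in bounded weights [w] *)

Lemma equicontinuous_fin (R : realType) (V : normedModType R) (I : finType) (f : I -> V -> R)
    (z : V) (e : R) : (forall i, {for z, continuous (f i)}) -> 0 < e ->
  exists2 r : R, 0 < r & forall x, `|x - z| <= r -> forall i, `|f i x - f i z| <= e.
Proof.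
move=> cf e0.
have : \forall x \near z, forall i, `|f i z - f i x| <= e.
  by apply: filter_forall => i; exact: ((cvgrPdist_le _ _).1 (cf i) e e0).
move=> /nbhs_ballP[d /= d0 dP].
exists (d / 2) => [|x xz i]; first by rewrite divr_gt0.
rewrite distrC; apply: dP; rewrite -ball_normE /= distrC; apply: le_lt_trans xz _; lra.
Qed.

Section PerturbedZero.
Variables (R : realType) (n : nat) (T : finType).
Variables (A b : 'I_n -> 'rV[R]_n -> R) (q : T -> 'I_n -> 'rV[R]_n -> R) (z : 'rV[R]_n).
Hypotheses (A2 : forall j, Ck 2 (A j)) (b2 : forall j, Ck 2 (b j)).
Hypotheses (q2 : forall t j, Ck 2 (q t j)).
Hypothesis Az : forall j, A j z = 0.

Let DA (x : 'rV[R]_n) : 'M[R]_n := \matrix_(j, l) 'D_(ev R l) (A j) x.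
Let Dw (w : T -> R) (x : 'rV[R]_n) : 'M[R]_n := \matrix_(j, l)
  ('D_(ev R l) (b j) x + \sum_t w t * 'D_(ev R l) (q t j) x).

(** The abstract form of [Gop]: [A] carries the large factor, [b] is the part free of contact
    forces, and the [q t] are the contact terms, linear in [w]; feasibility appears as
    [|w t| <= 1]. *)
Let G (al : R) (w : T -> R) (x : 'rV[R]_n) : 'rV[R]_n :=
  \row_j (al^-1 * A j x + b j x + \sum_t w t * q t j x).

Let V al w x := sqnorm (G al w x).

Lemma Ck_V al w : Ck 2 (V al w).
Proof.
have -> : V al w = (fun x => \sum_j (G al w x 0 j) * (G al w x 0 j)).
  by apply/funext => x; apply: eq_bigr => j _; rewrite expr2.
have C j : Ck 2 (fun x => G al w x 0 j).
  rewrite (_ : (fun x => _) = (fun x => al^-1 * A j x + b j x + \sum_t w t * q t j x)).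
    by apply: CkD; [apply: CkD => //; apply: CkM => //; exact: Ck_cst|
      apply: Ck_sum => t; apply: CkM => //; exact: Ck_cst].
  by apply/funext => x; rewrite mxE.
by apply: Ck_sum => j; exact: CkM.
Qed.

Lemma grad_V al w x : al != 0 ->
  grad (V al w) x = (2 / al) *: (G al w x *m (DA x + al *: Dw w x)).
Proof.
move=> al0; apply/rowP => l; rewrite !mxE.
have d1 (f : 'rV[R]_n -> R) : Ck 2 f -> is_derive x (ev R l) f ('D_(ev R l) f x).
  by case=> _ df _; exact: derivableP.
have dG j : is_derive x (ev R l) (fun x => G al w x 0 j)
   (al^-1 * 'D_(ev R l) (A j) x + 'D_(ev R l) (b j) x + \sum_t w t * 'D_(ev R l) (q t j) x).
  have dA := d1 _ (A2 j); have db := d1 _ (b2 j).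
  have dq : is_derive x (ev R l) (fun x => \sum_t w t * q t j x)
      (\sum_t w t * 'D_(ev R l) (q t j) x).
    by apply: is_derive_fsum => t; have := d1 _ (q2 t j) => ?; exact: is_deriveZ.
  have dA' : is_derive x (ev R l) (fun x => al^-1 * A j x) (al^-1 * 'D_(ev R l) (A j) x).
    exact: is_deriveZ.
  rewrite (_ : (fun x => _) = (fun x => al^-1 * A j x + b j x + \sum_t w t * q t j x)).
    by apply: is_deriveD.
  by apply/funext => y; rewrite mxE.
have dV : is_derive x (ev R l) (V al w) (\sum_j 2 * (G al w x 0 j *
   (al^-1 * 'D_(ev R l) (A j) x + 'D_(ev R l) (b j) x + \sum_t w t * 'D_(ev R l) (q t j) x))).
  have -> : V al w = (fun x => \sum_j (G al w x 0 j) * (G al w x 0 j)).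
    by apply/funext => y; apply: eq_bigr => j _; rewrite expr2.
  apply: is_derive_fsum => j; have dGj := dG j.
  by apply: is_derive_eq; rewrite /GRing.scale /= ; ring.
have [_ ->] := dV; rewrite mulr_sumr; apply: eq_bigr => j _.
rewrite !mxE.
by field.
Qed.

Hypothesis DAz : DA z \in unitmx.

Lemma DA_near e : 0 < e -> exists2 r : R, 0 < r & forall x : 'rV[R]_n, `|x - z| <= r ->
  forall j l, `|DA x j l - DA z j l| <= e.
Proof.
move=> e0.
have [|r r0 rP] := @equicontinuous_fin _ 'rV[R]_n _
    (fun jl : 'I_n * 'I_n => fun x => 'D_(ev R jl.2) (A jl.1) x) z e _ e0.
  by move=> jl; have [_ _ DA1] := A2 jl.1; have [cD _ _] := DA1 (ev R jl.2); exact: cD.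
by exists r => // x xz j l; rewrite !mxE; exact: (rP x xz (j, l)).
Qed.

Lemma Dw_bounded : exists2 M : R, 0 <= M & forall w, (forall t, `|w t| <= 1) ->
  forall x : 'rV[R]_n, `|x - z| <= 1 -> forall j l, `|Dw w x j l| <= M.
Proof.
have bnd (f : 'rV[R]_n -> R) : Ck 2 f -> exists M : 'I_n -> R, forall l, 0 <= M l /\
    forall x : 'rV[R]_n, `|x - z| <= 1 -> `|'D_(ev R l) f x| <= M l.
  case=> _ _ Df; suff /choice[M MP] : forall l, exists M : R, 0 <= M /\
    forall x : 'rV[R]_n, `|x - z| <= 1 -> `|'D_(ev R l) f x| <= M by exists M.
  move=> l; have [cD _ _] := Df (ev R l).
  by have [M M0 MP] := continuous_cube_bounded z 1 cD; exists M.
have /choice[Mb MbP] := fun j => bnd _ (b2 j).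
have /choice[Mq MqP] := fun tj : T * 'I_n => bnd _ (q2 tj.1 tj.2).
pose F j l := Mb j l + \sum_t Mq (t, j) l.
have F0 j l : 0 <= F j l.
  by rewrite addr_ge0 ?(MbP j l).1// sumr_ge0// => t _; exact: (MqP (t, j) l).1.
exists (\sum_j \sum_l F j l).
  by apply: sumr_ge0 => j _; apply: sumr_ge0.
move=> w w1 x xz j l; apply: (@le_trans _ _ (F j l)); last first.
  rewrite (bigD1 j)//= (bigD1 l)//= -addrA lerDl addr_ge0//; first exact: sumr_ge0.
  by apply: sumr_ge0 => k _; exact: sumr_ge0.
rewrite mxE; apply: le_trans (ler_normD _ _) _; rewrite lerD ?(MbP j l).2//.
apply: le_trans (ler_norm_sum _ _ _) _; apply: ler_sum => t _.
rewrite normrM -[leRHS]mul1r ler_pM//; exact: (MqP (t, j) l).2.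
Qed.

Lemma V_z_bounded : exists2 K : R, 0 < K & forall al w, (forall t, `|w t| <= 1) ->
  V al w z <= K ^+ 2.
Proof.
pose F j := `|b j z| + \sum_t `|q t j z|.
have F0 j : 0 <= F j by rewrite addr_ge0// sumr_ge0.
have S0 : 0 <= \sum_j F j by exact: sumr_ge0.
exists (\sum_j F j + 1); first by rewrite ltr_wpDl.
move=> al w w1; apply: le_trans (sqnorm_le_sum _) _.
have S1 : \sum_j `|G al w z 0 j| <= \sum_j F j.
  apply: ler_sum => j _; rewrite mxE Az mulr0 add0r.
  apply: le_trans (ler_normD _ _) _; rewrite lerD2l.
  apply: le_trans (ler_norm_sum _ _ _) _; apply: ler_sum => t _.
  by rewrite normrM -[leRHS]mul1r ler_wpM2r.
rewrite ler_sqr ?nnegrE; [|exact: sumr_ge0|by rewrite addr_ge0].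
by apply: le_trans S1 _; rewrite lerDl.
Qed.

(* [a] inverts [DA z] and [e] bounds both the variation of [DA] and the perturbation [al * Dw]. *)
Lemma gradient_dominated (a e al : R) w x : 0 < a -> 0 < al -> e = (4 * a * n.+1%:R)^-1 ->
  (forall u : 'rV[R]_n, `|u| <= a * `|u *m DA z|) ->
  (forall j l, `|DA x j l - DA z j l| <= e) ->
  (forall j l, al * `|Dw w x j l| <= e) ->
  4 * ((2 * a * n.+1%:R * al)^-1) ^+ 2 * V al w x <= sqnorm (grad (V al w) x).
Proof.
move=> a0 al0 ee aN eA ew; set u := G al w x; set P := DA x + al *: Dw w x.
have n1 : 0 < n.+1%:R :> R by rewrite ltr0Sn.
have n1' : n%:R <= n.+1%:R :> R by rewrite ler_nat.
have e0 : 0 < e by rewrite ee invr_gt0 !mulr_gt0.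
have PE : `|u *m (P - DA z)| <= n%:R * (2 * e) * `|u|.
  apply: mulmx_norm_le => [|j l]; first by rewrite mulr_ge0// ltW.
  rewrite /P addrAC !mxE; apply: le_trans (ler_normD _ _) _.
  have := eA j l; have := ew j l; rewrite !mxE normrM (gtr0_norm al0); lra.
have uP : `|u| <= 2 * a * `|u *m P|.
  have h1 := aN u.
  have h2 : `|u *m DA z| <= `|u *m P| + `|u *m (P - DA z)|.
    rewrite -[X in `|X| <= _](subKr (u *m P)) -mulmxBr; exact: ler_normB.
  (* The perturbation costs at most [|u| / 2], because [2 a n e = n / (2 (n + 1))], and is absorbed
     on the left. *)
  have h3 : a * (n%:R * (2 * e) * `|u|) <= `|u| / 2.
    rewrite ee; have -> : a * (n%:R * (2 * (4 * a * n.+1%:R)^-1) * `|u|) =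
       (n%:R / n.+1%:R) * (`|u| / 2).
      by field; rewrite !gt_eqF.
    by rewrite ler_piMl ?divr_ge0// ler_pdivrMr// mul1r.
  have h4 : a * `|u *m DA z| <= a * `|u *m P| + `|u| / 2.
    apply: le_trans (lerD (lexx _) h3); rewrite -mulrDr ler_pM2l//.
    by apply: le_trans h2 _; rewrite lerD2l.
  by move: h1 h4; lra.
apply: le_trans (norm_le_sqnorm _); rewrite grad_V ?gt_eqF// -/u -/P normrZ gtr0_norm ?divr_gt0//.
(* The rate [mu] of the statement satisfies [2 mu (n + 1) = 1 / (a * al)]: the factor [a * al] comes
   from [uP] and the [2 / al] in the gradient, the factor [n + 1] from bounding the Euclidean [V] by
   the sup norm of [u]. *)
have Vu : V al w x <= n.+1%:R ^+ 2 * `|u| ^+ 2.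
  apply: le_trans (sqnorm_le_norm (coord_le_norm u)) _.
  rewrite ler_wpM2r ?sqr_ge0//; apply: le_trans n1' _.
  by rewrite expr2 ler_peMl ?ler1n// ltW.
have c0 : 0 <= 4 * ((2 * a * n.+1%:R * al)^-1) ^+ 2 :> R by rewrite mulr_ge0// sqr_ge0.
apply: le_trans (ler_wpM2l c0 Vu) _.
have -> : 4 * ((2 * a * n.+1%:R * al)^-1) ^+ 2 * (n.+1%:R ^+ 2 * `|u| ^+ 2) =
   (`|u| / (a * al)) ^+ 2.
  by field; rewrite !gt_eqF.
rewrite ler_sqr ?nnegrE; last 2 first.
- by rewrite divr_ge0// ltW// mulr_gt0.
- by rewrite mulr_ge0// divr_ge0// ltW.
rewrite ler_pdivrMr ?mulr_gt0//; apply: le_trans uP _.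
by rewrite le_eqVlt; apply/orP; left; apply/eqP; field; rewrite gt_eqF.
Qed.

Theorem perturbed_zero_grad_flow : exists r : R, 0 < r /\ exists al1 : R, 0 < al1 /\
  forall al : R, 0 < al -> al <= al1 -> forall w : T -> R, (forall t, `|w t| <= 1) ->
  (exists th : R -> 'rV[R]_n, grad_flow (V al w) z th) /\
  (forall th : R -> 'rV[R]_n, grad_flow (V al w) z th ->
     exists ths : 'rV[R]_n,
       th t @[t --> +oo] --> ths /\ G al w ths = 0 /\ sqnorm (ths - z) <= r ^+ 2).
Proof.
have [a a0 aN] := unitmx_norm_le DAz.
have n1 : 0 < n.+1%:R :> R by rewrite ltr0Sn.
have n11 : 1 <= n.+1%:R :> R by rewrite ler1n.
pose e : R := (4 * a * n.+1%:R)^-1.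
have e0 : 0 < e by rewrite invr_gt0 !mulr_gt0.
have [r1 r10 r1P] := DA_near e0.
have [M M0 MP] := Dw_bounded.
have [K K0 KP] := V_z_bounded.
(* Within [r1] the Jacobian [DA] is close to [DA z]; the cap at [1] is the cube on which [Dw] is
   bounded. *)
pose r := Num.min r1 1.
have r0 : 0 < r by rewrite lt_min r10 ltr01.
have rr1 : r <= r1 by rewrite ge_min lexx.
have r_1 : r <= 1 by rewrite ge_min lexx orbT.
(* [c * al = 2 (n + 1) K / mu], so [al <= r / c] keeps the displacement [K / mu] below half of
   [r / (n + 1)]: the half makes it strictly less than [r], and [n + 1] turns the sup bound into a
   Euclidean one. The other bound on [al], below, keeps [al * Dw] within the tolerance [e]. *)
pose c := 4 * K * a * n.+1%:R ^+ 2.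
have c0 : 0 < c by rewrite !mulr_gt0// exprn_gt0.
have M1 : 0 < M + 1 by rewrite ltr_wpDl.
exists r; split => //; exists (Num.min (e / (M + 1)) (r / c)); split.
  by rewrite lt_min !divr_gt0.
move=> al al0; rewrite le_min => /andP[ale alr] w w1.
rewrite ler_pdivlMr// in ale; rewrite ler_pdivlMr// in alr.
pose mu := (2 * a * n.+1%:R * al)^-1.
have mu0 : 0 < mu by rewrite invr_gt0 !mulr_gt0.
have Kmu : n.+1%:R * (K / mu) <= r / 2.
  rewrite ler_pdivlMr//; apply: le_trans alr.
  by rewrite le_eqVlt; apply/orP; left; apply/eqP; rewrite /mu invrK /c; ring.
have Kmu0 : 0 <= K / mu by rewrite divr_ge0// ltW.
have Kmu' : K / mu < r.
  apply: (@le_lt_trans _ _ (r / 2)); last lra.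
  by apply: le_trans Kmu; rewrite ler_peMl.
have PL (x : 'rV[R]_n) : `|x - z| <= r -> 4 * mu ^+ 2 * V al w x <= sqnorm (grad (V al w) x).
  move=> xz; apply: (@gradient_dominated a e) => //; first exact/r1P/(le_trans xz).
  move=> j l; apply: le_trans ale; rewrite ler_pM2l//.
  by apply: le_trans (MP w w1 x (le_trans xz r_1) j l) _; rewrite lerDl.
have V2 := Ck_V al w.
have V0 x : 0 <= V al w x by exact: sqnorm_ge0.
split; first exact: (grad_flow_exists V2 V0 r0 mu0 K0 Kmu' PL (KP al w w1)).
move=> th thV.
have [ths [th_cvg Vths thsz]] := grad_flow_cvg V2 V0 r0 mu0 K0 Kmu' PL (KP al w w1) thV.
exists ths; split => //; split; first exact: sqnorm_eq0.
apply: le_trans (@sqnorm_le_norm _ _ _ (K / mu) _) _; first by move=> j; rewrite !mxE; exact: thsz.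
apply: (@le_trans _ _ ((n.+1%:R * (K / mu)) ^+ 2)).
  rewrite [leRHS]exprMn ler_wpM2r ?sqr_ge0//; apply: (@le_trans _ _ n.+1%:R); first by rewrite ler_nat.
  by rewrite expr2 ler_peMl// ltW.
rewrite ler_sqr ?nnegrE; [|by rewrite mulr_ge0|exact: ltW].
by apply: le_trans Kmu _; lra.
Qed.

End PerturbedZero.

(** * Integration of continuous functions over a bounded region of space *)

Section BoundedRegionIntegral.
Variable R : realType.
Local Notation mR := (measurableTypeR R).
Local Notation leb := (@lebesgue_measure R).
Local Notation mu3 := ((leb \x leb) \x leb)%E.

Lemma tr3_dist_le (p q : (R * R) * R) (e : R) : 0 <= e -> `|p.1.1 - q.1.1| <= e ->
  `|p.1.2 - q.1.2| <= e -> `|p.2 - q.2| <= e -> `|tr3 p - tr3 q| <= e.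
Proof.
move=> e0 h1 h2 h3; apply: norm_rV_le => // -[[|[|[|]]]] //= i3; rewrite !mxE //=.
Qed.

Let grid (k : nat) (x : R) : R := (Num.floor (x * k.+1%:R))%:~R / k.+1%:R.

Lemma grid_dist_le k x : `|grid k x - x| <= k.+1%:R^-1.
Proof.
have k0 : 0 < k.+1%:R :> R by rewrite ltr0Sn.
have /andP[h1 h2] := floor_itv (x * k.+1%:R).
rewrite intrD in h2.
have -> : grid k x - x = ((Num.floor (x * k.+1%:R))%:~R - x * k.+1%:R) / k.+1%:R.
  by rewrite mulrBl mulfK// gt_eqF.
rewrite normrM normfV (gtr0_norm k0) ler_piMl ?invr_ge0 ?(ltW k0)//.
by rewrite ler_norml; apply/andP; split; lra.
Qed.

Let cell (k : nat) (a : int) : set mR := `[a%:~R / k.+1%:R, (a + 1)%:~R / k.+1%:R[%classic.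

Lemma cellP k a x : cell k a x <-> Num.floor (x * k.+1%:R) = a.
Proof.
have k0 : 0 < k.+1%:R :> R by rewrite ltr0Sn.
rewrite /cell /= in_itv /= ler_pdivrMr// ltr_pdivlMr// -floor_eq.
by split => [/eqP|->].
Qed.

Lemma measurable_grid (f : 'rV[R]_3 -> R) k :
  measurable_fun [set: (mR * mR) * mR] (fun p => f (tr3 (grid k p.1.1, grid k p.1.2, grid k p.2))).
Proof.
move=> _ Y mY; rewrite setTI.
pose val (abc : (int * int) * int) := f (tr3 (abc.1.1%:~R / k.+1%:R, abc.1.2%:~R / k.+1%:R,
   abc.2%:~R / k.+1%:R)).
pose S (abc : (int * int) * int) : set ((mR * mR) * mR) :=
  if `[< Y (val abc) >] then (cell k abc.1.1 `*` cell k abc.1.2) `*` cell k abc.2 else set0.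
rewrite (_ : _ @^-1` Y = \bigcup_abc S abc); last first.
  apply/seteqP; split => [p /= Yp|p [abc _]].
    exists (Num.floor (p.1.1 * k.+1%:R), Num.floor (p.1.2 * k.+1%:R), Num.floor (p.2 * k.+1%:R)) => //.
    by rewrite /S asboolT//; split; [split|]; apply/cellP.
  rewrite /S; case: asboolP => // Yv [[/cellP h1 /cellP h2] /cellP h3] /=.
  by rewrite /grid h1 h2 h3.
apply: countable_bigcupT_measurable; first exact: countableP.
move=> abc; rewrite /S; case: ifP => // _.
by apply: measurableX; [apply: measurableX|]; exact: measurable_itv.
Qed.

(** Pointwise limit of the grid functions: each is constant on the boxes of a countable partition,
    and rounding moves a coordinate by at most [1 / (k + 1)]. The sigma-algebra is that of the
    triple product, row vectors being reached only through [tr3]. *)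
Lemma measurable_tr3 (f : 'rV[R]_3 -> R) : continuous f ->
  measurable_fun [set: (mR * mR) * mR] (f \o (@tr3 R)).
Proof.
move=> cf.
apply: (measurable_realfun.measurable_fun_cvg (fun k => measurable_grid f k)) => p _.
apply/cvgrPdist_le => e e0.
have /cvgrPdist_le /(_ e e0) := cf (tr3 p).
rewrite -nbhs_nearE => /nbhs_ballP[d /= d0 dP].
near=> k; apply: dP; rewrite -ball_normE /= distrC.
apply: (@le_lt_trans _ _ k.+1%:R^-1); last by near: k; exact: near_infty_natSinv_lt (PosNum d0).
by apply: tr3_dist_le; rewrite ?invr_ge0//; exact: grid_dist_le.
Unshelve. all: by end_near. Qed.

Variables (D : set 'rV[R]_3) (B : R).
Hypotheses (mD : measurable (@tr3 R @^-1` D)) (DB : forall x, D x -> `|x| <= B).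

Let mD' : measurable (@tr3 R @^-1` D : set ((mR * mR) * mR)).
Proof. exact: mD. Qed.

Lemma leb3_finite : (mu3 (@tr3 R @^-1` D) < +oo)%E.
Proof.
pose I : set mR := `[- B, B]%classic.
have mI : measurable I by exact: measurable_itv.
have mII : measurable (I `*` I) by exact: measurableX.
apply: (@le_lt_trans _ _ (mu3 ((I `*` I) `*` I))).
  apply: le_measure; rewrite ?inE//; first exact: measurableX.
  move=> p /= /DB pB.
  have H i := le_trans (coord_le_norm (tr3 p) i) pB.
  by split; [split|]; rewrite /I /= in_itv /= -ler_norml;
    [have := H 0|have := H 1|have := H 2%:R]; rewrite mxE.
have -> : mu3 ((I `*` I) `*` I) = (leb I * leb I * leb I)%E.
  transitivity ((leb \x leb)%E (I `*` I) * leb I)%E.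
    exact: (@product_measure1E _ _ _ _ R (leb \x leb)%E leb _ _ mII mI).
  by congr (_ * _)%E; exact: (@product_measure1E _ _ _ _ R leb leb _ _ mI mI).
have If : (leb I < +oo)%E.
  by rewrite /I lebesgue_measure_itv /=; case: ifP => _; rewrite ?ltry// -EFinB ltry.
by apply: lte_mul_pinfty => //; rewrite ?ge0_fin_numE ?mule_ge0//; apply: lte_mul_pinfty => //; rewrite ge0_fin_numE.
Qed.

Lemma integrable_tr3 (f : 'rV[R]_3 -> R) : continuous f ->
  mu3.-integrable (@tr3 R @^-1` D) (EFin \o (f \o (@tr3 R))).
Proof.
move=> cf; apply: measurable_bounded_integrable => //.
- exact: leb3_finite.
- exact: (measurable_funS measurableT (@subsetT _ _) (measurable_tr3 cf)).
have [M M0 MP] := continuous_cube_bounded 0 B cf.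
exists M; split; first exact: num_real.
move=> M' MM' p /= /DB pB; apply: le_trans (ltW MM').
by apply: MP; rewrite subr0.
Qed.

Lemma rint3B (f g : 'rV[R]_3 -> R) : continuous f -> continuous g ->
  rint3 D (fun x => f x - g x) = rint3 D f - rint3 D g.
Proof. by move=> cf cg; apply: (RintegralB mD' (integrable_tr3 cf) (integrable_tr3 cg)). Qed.

Lemma rint3Z (a : R) (f : 'rV[R]_3 -> R) : continuous f ->
  rint3 D (fun x => a * f x) = a * rint3 D f.
Proof. by move=> cf; apply: (RintegralZl _ mD' (integrable_tr3 cf)). Qed.

Lemma rint3_le : exists2 m : R, 0 <= m & forall (f : 'rV[R]_3 -> R) (e : R), continuous f ->
  (forall x, D x -> `|f x| <= e) -> `|rint3 D f| <= m * e.
Proof.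
exists (fine (mu3 (@tr3 R @^-1` D))); first exact: fine_ge0.
move=> f e cf fe; have If := integrable_tr3 cf.
apply: le_trans (le_normr_Rintegral mD' If) _.
rewrite mulrC -(Rintegral_cst _ mD'); apply: le_Rintegral => //.
- exact: (integrable_tr3 (normr_continuous cf)).
- apply: measurable_bounded_integrable => //; first exact: leb3_finite.
  by exists `|e|; split; [exact: num_real|move=> M eM p _ /=; exact: ltW].
- by move=> p Dp; exact: fe.
Qed.

End BoundedRegionIntegral.

(** * Integrals depending on a parameter *)

Section ParametricIntegral.
Variables (R : realType) (n : nat).
Implicit Types (x : 'rV[R]_3) (th u : 'rV[R]_n).

Lemma local_lipschitz_continuous (U W : normedModType R) (f : U -> W) (a : U) (C : R) :
  0 <= C -> (forall b, `|a - b| <= 1 -> `|f a - f b| <= C * `|a - b|) -> {for a, continuous f}.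
Proof.
move=> C0 fC; apply/cvgrPdist_le => e e0.
have C1 : 0 < C + 1 by rewrite ltr_wpDl.
have d0 : 0 < Num.min 1 (e / (C + 1)) by rewrite lt_min ltr01 divr_gt0.
apply/nbhs_ballP; exists (Num.min 1 (e / (C + 1))) => // b.
rewrite -ball_normE /= => /ltW; rewrite le_min => /andP[h1 h2].
rewrite ler_pdivlMr// in h2.
by apply: le_trans (fC b h1) _; apply: le_trans h2; rewrite mulrC ler_wpM2l// lerDl.
Qed.

Lemma lipschitz_continuous (U W : normedModType R) (F : U -> W) (L : R) :
  (forall a b, `|F a - F b| <= L * `|a - b|) -> continuous F.
Proof. by move=> FL; apply: (lipschitz_comp_continuous FL) => t; exact: cvg_id. Qed.

Lemma norm_row_mx_le x th (e : R) : `|x| <= e -> `|th| <= e -> `|row_mx x th| <= e.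
Proof.
move=> xe te; apply: norm_rV_le => [|j]; first exact: le_trans (normr_ge0 _) xe.
rewrite mxE; case: (fintype.split j) => i; [apply: le_trans xe|apply: le_trans te]; exact: coord_le_norm.
Qed.

Lemma row_mx_affine x th h u : row_mx x (h *: u + th) = h *: row_mx 0 u + row_mx x th.
Proof. by rewrite scale_row_mx add_row_mx scaler0 add0r. Qed.

Lemma row_mx_continuousl th : continuous (fun x => row_mx x th).
Proof.
apply: (@lipschitz_continuous _ _ _ 1) => a b.
rewrite mul1r opp_row_mx add_row_mx subrr; apply: norm_row_mx_le => //.
by rewrite normr0.
Qed.

Lemma row_mx_continuousr x : continuous (fun th => row_mx x th).
Proof.
apply: (@lipschitz_continuous _ _ _ 1) => a b.
rewrite mul1r opp_row_mx add_row_mx subrr; apply: norm_row_mx_le => //.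
by rewrite normr0.
Qed.

Lemma row_mx_lsub_continuous th : continuous (fun z : 'rV[R]_(3 + n) => row_mx (lsubmx z) th).
Proof.
apply: (@lipschitz_continuous _ _ _ 1) => a b.
rewrite mul1r opp_row_mx add_row_mx subrr; apply: norm_row_mx_le; last by rewrite normr0.
apply: norm_rV_le => // j; rewrite !mxE.
by apply: le_trans (coord_le_norm (a - b) (lshift n j)); rewrite !mxE.
Qed.

Lemma comp_continuous (T U W : topologicalType) (f : T -> U) (g : U -> W) :
  continuous f -> continuous g -> continuous (fun t => g (f t)).
Proof. by move=> cf cg t; apply: continuous_comp; [exact: cf|exact: cg]. Qed.

Variables (D : set 'rV[R]_3) (B : R).
Hypotheses (mD : measurable (@tr3 R @^-1` D)) (DB : forall x, D x -> `|x| <= B).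
Implicit Types F : 'rV[R]_(3 + n) -> R.

(** The integrand is a function of the joined variable [row_mx x th]; while [x] ranges over the
    bounded region, and [th] over a cube, the joined points stay in one cube, which makes Lipschitz
    constants uniform in [x]. *)
Let I F th := rint3 D (fun x => F (row_mx x th)).

Let cF F th : continuous F -> continuous (fun x => F (row_mx x th)).
Proof. by move=> cF; apply: (comp_continuous (@row_mx_continuousl th)). Qed.

Lemma row_mx_in_cube x th th0 (r : R) : D x -> `|th - th0| <= r ->
  `|row_mx x th - row_mx 0 th0| <= Num.max B r.
Proof.
move=> Dx tr; rewrite opp_row_mx add_row_mx; apply: norm_row_mx_le.
  by rewrite subr0 le_max DB.
by rewrite le_max tr orbT.
Qed.

Lemma rint3_param_continuous F : Ck 1 F -> continuous (I F).
Proof.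
move=> F1; have cF1 := Ck_continuous F1; have [m m0 mP] := rint3_le mD DB.
move=> th0; have [L L0 LP] := C1_cube_lipschitz (row_mx 0 th0) (Num.max B 1) F1.
apply: (@local_lipschitz_continuous _ _ (I F) th0 (m * L)) => [|th h1]; first by rewrite mulr_ge0.
rewrite /I -(rint3B mD DB (cF cF1) (cF cF1)) -mulrA.
apply: mP => [|x Dx].
- exact: (@CkB _ _ 0 _ _ (cF cF1) (cF cF1)).
- apply: le_trans (LP _ _ _ _) _.
  + by apply: row_mx_in_cube; rewrite // subrr normr0.
  + by apply: row_mx_in_cube; rewrite // distrC.
  + rewrite ler_wpM2l// opp_row_mx add_row_mx subrr; apply: norm_row_mx_le => //.
    by rewrite normr0.
Qed.

(** By the mean value theorem the difference quotient of the integrand is [G] at the parameter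
    [(c * h) *: u + th], which differs from [G] at [th] by at most [L |h| |u|] uniformly in [x];
    integrating multiplies this by the volume [m]. [Ck 2] is what makes [G] Lipschitz on cubes. *)
Lemma rint3_param_derive F th u : Ck 2 F ->
  is_derive th u (I F) (I (fun z => 'D_(row_mx 0 u) F z) th).
Proof.
move=> F2; have cF0 := Ck_continuous F2; have [m m0 mP] := rint3_le mD DB.
have [_ dF DF] := F2; set w := row_mx 0 u; pose G z := 'D_w F z.
have G1 : Ck 1 G := DF w.
have cG := Ck_continuous G1.
have [L L0 LP] := C1_cube_lipschitz (row_mx 0 th) (Num.max B `|u|) G1.
apply: is_derive_cvg; apply/cvgrPdist_le => e e0.
have mL : 0 < m * L * `|u| + 1 by rewrite ltr_wpDl// !mulr_ge0.
near=> h.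
have h0 : h != 0 by near: h; exact: nbhs_dnbhs_neq.
have h1 : `|h| <= 1 by near: h; apply: dnbhs0_le.
have h2 : `|h| <= e / (m * L * `|u| + 1) by near: h; apply: dnbhs0_le; rewrite divr_gt0.
rewrite ler_pdivlMr// in h2.
rewrite /I -(rint3B mD DB (cF cF0) (cF cF0)).
have cB : continuous (fun x => F (row_mx x (h *: u + th)) - F (row_mx x th)).
  exact: (@CkB _ _ 0 _ _ (cF cF0) (cF cF0)).
rewrite -[_ *: _]/(h^-1 * _) -(rint3Z mD DB _ cB).
rewrite -/G; have cZ : continuous (fun x => h^-1 * (F (row_mx x (h *: u + th)) - F (row_mx x th))).
  exact: (@CkM _ _ 0 _ _ (@Ck_cst _ _ _ 0 h^-1) cB).
rewrite -(rint3B mD DB (cF cG) cZ).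
apply: le_trans (mP _ (L * (`|h| * `|u|)) _ _) _.
- exact: (@CkB _ _ 0 _ _ (cF cG) cZ).
- move=> x Dx; rewrite row_mx_affine -/w.
  have [c /andP[c0 c1] ->] := MVT_dir (row_mx x th) (fun z => dF z (h *: w)).
  rewrite deriveZ_dir// mulrA mulVf// mul1r -/(G _) -/(G _).
  have cw : c *: (h *: w) + row_mx x th = row_mx x ((c * h) *: u + th).
    by rewrite scalerA row_mx_affine.
  have chu : `|(c * h) *: u| <= `|h| * `|u|.
    by rewrite normrZ normrM (ger0_norm c0) ler_wpM2r// ler_piMl.
  rewrite cw; apply: le_trans (LP _ _ _ _) _.
  + by apply: row_mx_in_cube; rewrite // subrr normr0.
  + apply: row_mx_in_cube; rewrite // addrK; apply: le_trans chu _.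
    by rewrite ler_piMl.
  + rewrite ler_wpM2l// opp_row_mx add_row_mx subrr; apply: norm_row_mx_le.
      by rewrite normr0 mulr_ge0.
    by rewrite opprD addrCA subrr addr0 normrN.
apply: le_trans h2; rewrite (_ : m * _ = `|h| * (m * L * `|u|)); last by ring.
by rewrite ler_wpM2l// lerDl.
Unshelve. all: by end_near. Qed.

(** One order is lost because continuity and differentiability are both drawn from Lipschitz
    estimates, which ask for one more derivative; the smooth integrands of the robot can afford
    it. *)
Lemma Ck_rint3_param k F : Ck k.+1 F -> Ck k (I F).
Proof.
elim: k F => [|k IH] F F1; first exact: rint3_param_continuous.
have F2 : Ck 2 F by apply: Ck_le F1.
split.
- exact/rint3_param_continuous/(CkW F2).
- by move=> th u; have [] := rint3_param_derive th u F2.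
move=> u; have -> : (fun th => 'D_u (I F) th) = I (fun z => 'D_(row_mx 0 u) F z).
  by apply/funext => th; have [_ ->] := rint3_param_derive th u F2.
by apply: IH; case: F1 => _ _; exact.
Qed.

End ParametricIntegral.

(** * The robot: [Gop] brought to the abstract form *)

Lemma sigma_min_unitmx (R : realType) n (M : 'M[R]_n) (s : R) : 0 < s -> sigma_min_ge M s ->
  M \in unitmx.
Proof.
move=> s0 Ms; rewrite -unitmx_tr unitmxE unitfE; apply/negP => /det0P[y y0 yM].
have : eigenvalue (M^T *m M) 0.
  by apply/eigenvalueP; exists y => //; rewrite mulmxA yM mul0mx scale0r.
by move/Ms; rewrite sqrtr0 leNgt s0.
Qed.

Section RobotDynamics.
Variables (R : realType) (n : nat) (rho dt : R) (region : set 'rV[R]_3).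
Variables (X : 'rV[R]_3 -> 'rV[R]_n -> 'rV[R]_3) (thm thmm tau : 'rV[R]_n).
Variables (m : nat) (c : 'I_m -> 'rV[R]_3) (Vd : 'I_m -> nat).
Variable (v : forall i : 'I_m, 'rV[R]_n -> 'M[R]_(3, Vd i)).
Hypothesis mregion : measurable (@tr3 R @^-1` region).
Variable B : R.
Hypothesis regionB : forall x, region x -> `|x| <= B.

Let Z (z : 'rV[R]_(3 + n)) := X (lsubmx z) (rsubmx z).
Hypothesis smoothZ : smooth Z.
Hypothesis v3 : forall i, Ck 3 (v i).

Implicit Types z : 'rV[R]_(3 + n).

Let w_ (j : 'I_n) : 'rV[R]_(3 + n) := row_mx 0 (ev R j).
Let dZ j z : 'rV[R]_3 := 'D_(w_ j) Z z.

Lemma XE x : X x = Z \o row_mx x.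
Proof. by apply/funext => th; rewrite /Z /= row_mxKl row_mxKr. Qed.

Lemma jacE x th k j : jac X x th k j = dZ j (row_mx x th) 0 k.
Proof.
by rewrite mxE XE (@derive_affine _ _ _ (row_mx x) (row_mx 0)) // => h p u; exact: row_mx_affine.
Qed.

Lemma Ck_Z K k : Ck K (fun z => Z z 0 k).
Proof. exact/Ck_mxcoord/smoothZ. Qed.

Lemma Ck_dZ K j k : Ck K (fun z => dZ j z 0 k).
Proof. by apply: Ck_mxcoord; have [_ _] := smoothZ K.+1; exact. Qed.

Lemma row_mx_lsub_affine (th : 'rV[R]_n) h (p u : 'rV[R]_(3 + n)) :
  row_mx (lsubmx (h *: u + p)) th = h *: row_mx (lsubmx u) 0 + row_mx (lsubmx p) th.
Proof. by rewrite linearP scale_row_mx add_row_mx scaler0 add0r. Qed.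

Lemma Ck_Z_fixed K th k : Ck K (fun z => Z (row_mx (lsubmx z) th) 0 k).
Proof.
apply: (@Ck_affine _ _ _ _ _ (row_mx_lsub_affine th) _ K (fun z => Z z 0 k)).
  exact: row_mx_lsub_continuous.
exact: Ck_Z.
Qed.

Let FA j z : R := rho / dt ^+ 2 *
  \sum_k (Z z 0 k - Z (row_mx (lsubmx z) thm) 0 k) * dZ j z 0 k.
Let FB j z : R := rho / dt ^+ 2 *
  \sum_k (Z (row_mx (lsubmx z) thmm) 0 k - Z (row_mx (lsubmx z) thm) 0 k) * dZ j z 0 k.

Lemma Ck_FA K j : Ck K (FA j).
Proof.
apply: CkM; first exact: Ck_cst.
apply: Ck_sum => k; apply: CkM; last exact: Ck_dZ.
by apply: CkB; [exact: Ck_Z|exact: Ck_Z_fixed].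
Qed.

Lemma Ck_FB K j : Ck K (FB j).
Proof.
apply: CkM; first exact: Ck_cst.
apply: Ck_sum => k; apply: CkM; last exact: Ck_dZ.
by apply: CkB; exact: Ck_Z_fixed.
Qed.

Let A j th := rint3 region (fun x => FA j (row_mx x th)).
Let b j th := rint3 region (fun x => FB j (row_mx x th)) - tau 0 j.

Lemma AopE th j : Aop rho dt region X thm th 0 j = A j th.
Proof.
rewrite mxE; congr rint3; apply/funext => x; rewrite mxE; congr (_ * _).
by apply: eq_bigr => k _; rewrite jacE !mxE XE /= row_mxKl.
Qed.

Lemma Ck_A K j : Ck K (A j).
Proof. by apply: (Ck_rint3_param mregion regionB); exact: Ck_FA. Qed.

Lemma Ck_b K j : Ck K (b j).
Proof.
apply: CkB; last exact: Ck_cst.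
by apply: (Ck_rint3_param mregion regionB); exact: Ck_FB.
Qed.

Lemma A_thm j : A j thm = 0.
Proof.
rewrite /A (_ : (fun x => _) = (fun x => 0 * 0)).
  by rewrite (rint3Z mregion regionB 0 (@Ck_cst _ _ _ 0 (0 : R))) mul0r.
apply/funext => x; rewrite mulr0 /FA big1 ?mulr0// => k _.
by rewrite row_mxKl subrr mul0r.
Qed.

(** The factor [X x th - X x thm] vanishes at [thm], so the product rule keeps only the term in
    which it is differentiated, and the second derivatives of [X] drop out. *)
Lemma derive_A_thm j l : 'D_(ev R l) (A j) thm = Mmat rho dt region X thm j l.
Proof.
have [_ ->] := rint3_param_derive mregion regionB thm (ev R l) (Ck_FA 2 j).
rewrite mxE; congr rint3; apply/funext => x; rewrite -/(w_ l).
set p := row_mx x thm.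
have d1 (f : 'rV[R]_(3 + n) -> R) : Ck 1 f -> is_derive p (w_ l) f ('D_(w_ l) f p).
  by case=> _ df _; exact: derivableP.
have dZk k : is_derive p (w_ l) (fun z => Z z 0 k) (dZ l p 0 k).
  by apply: is_derive_mxcoord; have [_ dZ1 _] := smoothZ 1; exact: derivableP.
(* The direction [w_ l] moves only the parameter, which this map overwrites by [thm]. *)
have dZ0 k : is_derive p (w_ l) (fun z => Z (row_mx (lsubmx z) thm) 0 k) 0.
  have d := d1 _ (Ck_Z_fixed 1 thm k); split; first by case: d.
  rewrite (@derive_affine _ _ _ _ _ (row_mx_lsub_affine thm) _ (fun z => Z z 0 k)).
  by rewrite /w_ !row_mxKl row_mx0 derive0.
have dFA : is_derive p (w_ l) (FA j) (rho / dt ^+ 2 * \sum_k dZ j p 0 k * dZ l p 0 k).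
  apply: is_deriveZ; apply: is_derive_fsum => k.
  have h1 := dZk k; have h2 := dZ0 k; have h3 := d1 _ (Ck_dZ 1 j k).
  have h4 : is_derive p (w_ l) (fun z => Z z 0 k - Z (row_mx (lsubmx z) thm) 0 k) (dZ l p 0 k).
    by apply: is_derive_eq; rewrite subr0.
  apply: is_derive_eq; rewrite /GRing.scale /= row_mxKl subrr mul0r add0r.
  by [].
have [_ ->] := dFA; rewrite mxE; congr (_ * _); apply: eq_bigr => k _.
by rewrite [X in _ = X * _]mxE !jacE.
Qed.

(** Pairs of a contact point and one of its force components: the dependent family [w] is flattened
    to a function on one finite type. *)
Let T : finType := {i : 'I_m & 'I_(Vd i)}.
Let q (t : T) (j : 'I_n) th : R :=
  - \sum_a v (tag t) th a (tagged t) * dZ j (row_mx (c (tag t)) th) 0 a.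

Lemma Ck_q t j : Ck 2 (q t j).
Proof.
apply/CkN/Ck_sum => a; apply: CkM; first exact/Ck_mxcoord/CkW/v3.
apply: (@Ck_affine _ _ _ (row_mx (c (tag t))) (row_mx 0) _ _ 2 (fun z => dZ j z 0 a)).
- by move=> h p u; exact: row_mx_affine.
- exact: row_mx_continuousr.
- exact: Ck_dZ.
Qed.

Lemma GopE al th (w : forall i : 'I_m, 'cV[R]_(Vd i)) :
  Gop rho dt region X thm thmm tau c v al th w =
  \row_j (al^-1 * A j th + b j th + \sum_(t : T) w (tag t) (tagged t) 0 * q t j th).
Proof.
apply/rowP => j; rewrite [LHS]mxE [X in X + _]mxE AopE [RHS]mxE -addrA; congr (_ + _).
rewrite [LHS]mxE [X in X + _]mxE [X in X + _ + _]mxE [X in _ + _ + X]mxE /b.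
rewrite addrAC; congr (_ + _); first congr (_ - _).
  congr rint3; apply/funext => x; rewrite mxE; congr (_ * _).
  by apply: eq_bigr => k _; rewrite jacE !mxE XE /= row_mxKl.
rewrite mxE summxE -sumrN.
transitivity (\sum_(i < m) \sum_(k < Vd i)
    w i k 0 * - \sum_a v i th a k * dZ j (row_mx (c i) th) 0 a); last first.
  by rewrite sig_big_dep.
apply: eq_bigr => i _; rewrite mxE.
under [in RHS]eq_bigr do rewrite mulrN mulr_sumr.
rewrite [RHS]sumrN exchange_big /=; congr (- _); apply: eq_bigr => a _.
rewrite jacE !mxE mulr_suml; apply: eq_bigr => k _; ring.
Qed.

Lemma robot_grad_flow (sigmaX : R) :
  0 < sigmaX -> sigma_min_ge (Mmat rho dt region X thm) sigmaX ->
  exists r : R, 0 < r /\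
  exists al1 : R, 0 < al1 /\
  forall al : R, 0 < al -> al <= al1 ->
  forall w : forall i : 'I_m, 'cV[R]_(Vd i), feasible w ->
  let V := fun th => Vop rho dt region X thm thmm tau c v al th w in
  (exists th : R -> 'rV[R]_n, grad_flow V thm th) /\
  (forall th : R -> 'rV[R]_n, grad_flow V thm th ->
     exists ths : 'rV[R]_n,
       th t @[t --> +oo] --> ths /\
       Gop rho dt region X thm thmm tau c v al ths w = 0 /\
       sqnorm (ths - thm) <= r ^+ 2).
Proof.
move=> s0 Ms.
have MD : \matrix_(j, l) 'D_(ev R l) (A j) thm = Mmat rho dt region X thm.
  by apply/matrixP => j l; rewrite mxE derive_A_thm.
have := perturbed_zero_grad_flow (Ck_A 2) (Ck_b 2) Ck_q A_thm.
rewrite MD => /(_ (sigma_min_unitmx s0 Ms)) [r [r0 [al1 [al10 H]]]].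
exists r; split => //; exists al1; split => // al al0 al_le w fw V.
have w1 (t : T) : `|w (tag t) (tagged t) 0| <= 1.
  have [wp ws] := fw (tag t); rewrite ger0_norm//; apply: le_trans ws.
  by rewrite (bigD1 (tagged t))//= lerDl sumr_ge0.
have := H al al0 al_le _ w1.
have -> : (fun x => sqnorm (\row_j (al^-1 * A j x + b j x +
    \sum_(t : T) w (tag t) (tagged t) 0 * q t j x))) = V.
  by apply/funext => x; rewrite /V /Vop GopE.
case=> Hex Hcv; split => // th /Hcv[ths [h1 [h2 h3]]].
by exists ths; rewrite GopE.
Qed.

End RobotDynamics.

(** Existence stands apart from convergence because [grad_flow] leaves a curve free at negative
    times: the flow is not a single function, and convergence is claimed for every one of them. *)
Theorem theorem3 (R : realType) (n : nat) (rho dt : R)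
  (region : set 'rV[R]_3) (X : 'rV[R]_3 -> 'rV[R]_n -> 'rV[R]_3)
  (thm thmm tau : 'rV[R]_n) (m : nat) (c : 'I_m -> 'rV[R]_3)
  (Vd : 'I_m -> nat) (v : forall i : 'I_m, 'rV[R]_n -> 'M[R]_(3, Vd i))
  (sigmaX : R) :
  0 < rho -> 0 < dt ->
  measurable (tr3 (R:=R) @^-1` region) ->
  (exists B : R, forall x, region x -> `|x| <= B) ->
  (forall i, region (c i)) -> injective c ->
  (* (A1) *)
  smooth (fun z : 'rV[R]_(3 + n) => X (lsubmx z) (rsubmx z)) ->
  (* (A2) *)
  0 < sigmaX -> sigma_min_ge (Mmat rho dt region X thm) sigmaX ->
  (* (A3) *)
  (forall i, Ck 3 (v i)) ->
  exists r : R, 0 < r /\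
  exists al1 : R, 0 < al1 /\
  forall al : R, 0 < al -> al <= al1 ->
  forall w : forall i : 'I_m, 'cV[R]_(Vd i), feasible w ->
  let V := fun th => Vop rho dt region X thm thmm tau c v al th w in
  (exists th : R -> 'rV[R]_n, grad_flow V thm th) /\
  (forall th : R -> 'rV[R]_n, grad_flow V thm th ->
     exists ths : 'rV[R]_n,
       th t @[t --> +oo] --> ths /\
       Gop rho dt region X thm thmm tau c v al ths w = 0 /\
       sqnorm (ths - thm) <= r ^+ 2).
Proof.
move=> _ _ mregion [B regionB] _ _ smoothX s0 Ms v3.
exact: (robot_grad_flow thmm tau c mregion regionB smoothX v3 s0 Ms).
Qed.
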